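(* For each integer $k\ge 1$ let $G_k$ be the graph corresponding to the A2-$k$ tiling (generation $k$ of the Ammann A2 tiling), let $V(k)$ be the number of vertices of $G_k$, and let $T(k)$ be the sum of the degrees of all vertices of $G_k$. Let $F(n)$ denote the $n$th Fibonacci number ($F(1)=F(2)=1$, $F(3)=2$) and $\phi=\frac{1+\sqrt5}{2}$. Then for every integer $k\ge 7$: If $k$ is even, $$V(k)=1+\tfrac12 F\left(\tfrac{k}{2}\right)+F\left(\tfrac{k}{2}+1\right)+2F\left(\tfrac{k}{2}-1\right)-\tfrac12 F\left(\tfrac{k}{2}-3\right)+\left(\tfrac{31}{2}+\tfrac{69}{2\sqrt5}\right)\left(\tfrac{1+\sqrt5}{2}\right)^{k-7}+\left(\tfrac{31}{2}-\tfrac{69}{2\sqrt5}\right)\left(\tfrac{1-\sqrt5}{2}\right)^{k-7},$$ $$T(k)=F\left(\tfrac{k}{2}\right)+2F\left(\tfrac{k}{2}+1\right)+4F\left(\tfrac{k}{2}-1\right)-F\left(\tfrac{k}{2}-3\right)+\left(44+\tfrac{98}{\sqrt5}\right)\left(\tfrac{1+\sqrt5}{2}\right)^{k-7}+\left(44-\tfrac{98}{\sqrt5}\right)\left(\tfrac{1-\sqrt5}{2}\right)^{k-7}.$$ If $k$ is odd, $$V(k)=1+2F\left(\tfrac{k+1}{2}\right)+F\left(\tfrac{k-1}{2}\right)+\left(\tfrac{31}{2}+\tfrac{69}{2\sqrt5}\right)\left(\tfrac{1+\sqrt5}{2}\right)^{k-7}+\left(\tfrac{31}{2}-\tfrac{69}{2\sqrt5}\right)\left(\tfrac{1-\sqrt5}{2}\right)^{k-7},$$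 $$T(k)=4F\left(\tfrac{k+1}{2}\right)+2F\left(\tfrac{k-1}{2}\right)+\left(44+\tfrac{98}{\sqrt5}\right)\left(\tfrac{1+\sqrt5}{2}\right)^{k-7}+\left(44-\tfrac{98}{\sqrt5}\right)\left(\tfrac{1-\sqrt5}{2}\right)^{k-7}.$$ The average degree of $G_k$ is $T(k)/V(k)$, and the average degree of the limiting graph, i.e. the limit of these average degrees, is $$\lim_{k\to\infty}\frac{T(k)}{V(k)}=\frac{44+\frac{98}{\sqrt5}}{\frac{31}{2}+\frac{69}{2\sqrt5}}=\frac{2}{11}\left(14+\phi\right).$$
   Context: Let $\phi=\frac{1+\sqrt5}{2}$ and $\Psi=1/\sqrt{\phi}$, so $\Psi^4+\Psi^2=1$. Tiles. The large A2 tile is (up to similarity) the closed right-angled hexagon $H$ with consecutive vertices $(0,0),(1,0),(1,\Psi),(\Psi^4,\Psi),(\Psi^4,\Psi^3),(0,\Psi^3)$; its consecutive side lengths, from the longest side, are $1,\Psi,\Psi^2,\Psi^5,\Psi^4,\Psi^3$. The small tile is a copy of $H$ scaled by $\Psi$. Tiles may be rotated and reflected. Substitution. A small tile is replaced by a large tile occupying the same region, and a large tile is replaced by one large and one small tile which together fill it; the new tiles are scaled by $\Psi$ compared with the old ones. For the large tile $H$ the new large tile is $f_1(H)$ and the new small tile is $f_2(H)$, where $$f_1(x,y)=(1-\Psi y,\ \Psi x),\qquad f_2(x,y)=(\Psi^2-\Psi^2x,\ \Psi^2 y).$$ Other tiles are treated by transporting this rule by similarities (including reflections). Generation 1 (A2-1)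 is a single small tile, and generation $n+1$ (A2-$(n+1)$) is obtained by applying the substitution $n$ times to a single small tile. Equivalently, up to similarity, A2-$k$ is the finite tiling $P_k$ of $H$ given by $P_1=P_2=\{H\}$ and $P_{k+2}=\{f_1(S):S\in P_{k+1}\}\cup\{f_2(S):S\in P_k\}$ for $k\ge1$. Graph. The graph corresponding to A2-$k$ has as vertices all points of the plane that are a corner (one of the six vertices) of at least one tile. Its edges come from the sides of the tiles: if a corner of another tile lies in the interior of a side, the side is subdivided there, so the edges are the segments contained in tile sides joining two vertices with no other vertex between them; a segment lying on the boundary of two tiles counts as one edge. The degree of a vertex is the number of edges containing it as an endpoint, and the average degree is the sum of all degrees divided by the number of vertices. *)

(* Defs.v *)
From HB Require Import structures.
From mathcomp Require Import all_boot all_order all_algebra.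
From mathcomp Require Import finmap.
From mathcomp Require Import all_classical all_reals all_analysis.

Set Implicit Arguments.
Unset Strict Implicit.
Unset Printing Implicit Defensive.

Import Order.TTheory GRing.Theory Num.Theory.
Import numFieldNormedType.Exports.

Local Open Scope classical_set_scope.
Local Open Scope ring_scope.

Fixpoint fib (n : nat) : nat :=
  match n with
  | 0 => 0
  | n'.+1 => if n' is n''.+1 then (fib n' + fib n'')%N else 1
  end.

Definition phi (R : realType) : R := (1 + Num.sqrt 5) / 2.
Definition Psi (R : realType) : R := (Num.sqrt (phi R))^-1.

Notation plane R := (R * R)%type (only parsing).

Definition hexagon (R : realType) : seq (plane R) :=
  let P := Psi R in
  [:: (0, 0); (1, 0); (1, P); (P ^+ 4, P); (P ^+ 4, P ^+ 3); (0, P ^+ 3)].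

Definition f1 (R : realType) (p : plane R) : plane R :=
  (1 - Psi R * p.2, Psi R * p.1).
Definition f2 (R : realType) (p : plane R) : plane R :=
  (Psi R ^+ 2 - Psi R ^+ 2 * p.1, Psi R ^+ 2 * p.2).

(* A tile is the image of the hexagon under the similarity [place], together
   with its kind.  The actual size is part of [place]; [large] only decides
   which substitution rule applies. *)
Record tile (R : realType) : Type := Tile {
  large : bool;
  place : plane R -> plane R
}.

Definition corners (R : realType) (t : tile R) : seq (plane R) :=
  map (place t) (hexagon R).

Definition sides (R : realType) (t : tile R) : seq (plane R * plane R) :=
  zip (corners t) (rot 1 (corners t)).

(* The rule for the reference hexagon, transported along [place t]. *)
Definition subst_tile (R : realType) (t : tile R) : seq (tile R) :=
  if large t then
    [:: Tile true (place t \o @f1 R); Tile false (place t \o @f2 R)]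
  else [:: Tile true (place t)].

Definition subst (R : realType) (P : seq (tile R)) : seq (tile R) :=
  flatten (map (@subst_tile R) P).

(* Generation k >= 1, up to similarity: the small starting tile is normalised
   to occupy the reference hexagon.  The value at k = 0 is irrelevant. *)
Definition A2 (R : realType) (k : nat) : seq (tile R) :=
  iter k.-1 (@subst R) [:: Tile false id].

Definition segment (R : realType) (a b : plane R) : set (plane R) :=
  [set p | exists2 t : R, 0 <= t <= 1 &
     p = ((1 - t) * a.1 + t * b.1, (1 - t) * a.2 + t * b.2)].

Definition vertices (R : realType) (P : seq (tile R)) : {fset plane R} :=
  [fset p in flatten (map (@corners R) P)]%fset.

Definition edge_ends (R : realType) (P : seq (tile R)) (x y : plane R) : Prop :=
  [/\ x \in vertices P, y \in vertices P, x != y,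
      exists2 s : plane R * plane R,
        s \in flatten (map (@sides R) P) &
        segment x y `<=` segment s.1 s.2 &
      forall z, z \in vertices P -> segment x y z -> z = x \/ z = y].

(* An edge is a straight segment, encoded by the set of its two endpoints, so
   a segment shared by two tiles is counted once. *)
Definition edges (R : realType) (P : seq (tile R)) : {fset {fset plane R}} :=
  [fset e in fpowerset (vertices P) |
     `[< exists x y, edge_ends P x y /\ e = [fset x; y]%fset >]]%fset.

Definition degree (R : realType) (P : seq (tile R)) (v : plane R) : nat :=
  #|` [fset e in edges P | v \in e]%fset|.

Definition num_vertices (R : realType) (P : seq (tile R)) : nat :=
  #|` vertices P|.

Definition degree_sum (R : realType) (P : seq (tile R)) : nat :=
  (\sum_(v <- vertices P) degree P v)%N.

Definition avg_degree (R : realType) (P : seq (tile R)) : R :=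
  (degree_sum P)%:R / (num_vertices P)%:R.

(* Main.v *)
Require Import Defs.
From HB Require Import structures.
From mathcomp Require Import all_boot all_order all_algebra.
From mathcomp Require Import finmap.
From mathcomp Require Import all_classical all_reals all_analysis.
From mathcomp Require Import ring lra zify.
Import Order.TTheory GRing.Theory Num.Theory.
Import numFieldNormedType.Exports.
Local Open Scope classical_set_scope.
Local Open Scope ring_scope.

Set Implicit Arguments.
Unset Strict Implicit.
Unset Printing Implicit Defensive.

(** The cut of the hexagon into a large and a small part turns the graph of a
    generation into the graphs of the two preceding generations glued along a
    seam, and on the seam the two parts have the same vertices.  Everything
    else is counting.

    Coordinates.  Dividing ordinates by Psi turns f1 and f2 into maps [g1] and
    [g2] whose coefficients involve only t = Psi^2, and t^2 = 1 - t.  Let V(n)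
    and E(n) be the numbers of vertices and edges of the rescaled generation
    n + 1 ([patchV], [patchE]).

    Boundary.  Parametrise the six sides of the hexagon H affinely by [0, 1]
    ([side]).  As [g1] and [g2] carry sides, or parts of them, onto sides, the
    vertices of generation n + 1 on side i are described by a single sequence of
    finite sets: they are the points [side i u] with u in [marks (n - i)]
    ([side_vertex]); and each stretch of a side between two consecutive
    vertices is contained in a side of a tile ([side_cover]).

    Seam.  The regions g1(H) and g2(H) meet in a staircase made of three
    segments.  It is the image under [g2] of the sides 3, 4, 5, and the image
    under [g1] of the sides 4, 5 and of a part of side 2.  The indices of the
    sets of marks agree, so both parts have the same vertices there, with one
    exception: for n <= 2 a corner of the small part lies inside an edge of the
    large part.  Adding this point to the large part ([patchV_top]) creates one
    vertex and one edge ([card_patchE_top]); after that the union of the two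
    graphs subdivides no edge ([patchE_step]).  The staircase is a path, so if it
    carries s vertices it carries s - 1 edges ([card_patchE_cap]).  With the
    correction d = 1 for n <= 2 and d = 0 otherwise,

        V(n+2) = V(n+1) + d + V(n) - s,   E(n+2) = E(n+1) + d + E(n) - (s - 1).

    Numbers.  The difference of the two recurrences gives
    E(n) + 1 = V(n) + F(n+1) ([euler]).  The set [marks (m + 2)] is made of
    shrunk copies of [marks m] and [marks (m - 2)] with one common point, so its
    cardinality is a Fibonacci number of index about m / 2 plus 1 ([card_marks]);
    this is where the terms F(k/2) come from.  Solving the recurrence for V
    ([num_vertices_pairs]), doubling E ([handshake], [degree_sum_pairs]) and
    applying the formula of Binet ([binet]) gives the closed forms.  In the limit
    only the multiples of phi^(k-7) count, because F(k/2) is of order phi^(k/2)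
    ([cvg_boundary_term]). *)

(** * Segments in the plane *)

Section PlanarGraphs.
Variable R : realType.
Local Notation plane := (R * R)%type.
Implicit Types (a b p q w x y z : plane) (S : seq (plane * plane)).
Implicit Types (W : {fset plane}) (f : plane -> plane).

Definition lerp a b (t : R) : plane :=
  ((1 - t) * a.1 + t * b.1, (1 - t) * a.2 + t * b.2).

Lemma segment_l a b : segment a b a.
Proof.
exists 0; first by rewrite lexx ler01.
by case: a => a1 a2; rewrite /= subr0 !mul1r !mul0r !addr0.
Qed.

Lemma segmentC a b : segment a b = segment b a.
Proof.
have sub c d : segment c d `<=` segment d c; last by rewrite eqEsubset; split.
move=> p [t t01 ->]; exists (1 - t); first lra.
by rewrite subKr [in LHS]addrC [X in (_, X)]addrC.
Qed.

Lemma segment_r a b : segment a b b.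
Proof. by rewrite segmentC; exact: segment_l. Qed.

Lemma sub_segment a b p q :
  segment a b p -> segment a b q -> segment p q `<=` segment a b.
Proof.
move=> [t t01 ->] [u u01 ->] _ [v v01 ->].
exists ((1 - v) * t + v * u); first by nra.
by congr pair => /=; ring.
Qed.

(** On the line through a and b, w comes before b and b comes before w. *)
Lemma segment_antisym a b w : segment a b w -> segment a w b -> w = b.
Proof.
move=> [t t01 ->] [u u01 /= eb].
have [u1|u1] := eqVneq (u * t) 1.
  have -> : t = 1 by nra.
  by case: (b) => b1 b2 /=; congr pair; ring.
have bE c d : d = (1 - u) * c + u * ((1 - t) * c + t * d) -> c = d.
  move=> /eqP; rewrite -subr_eq0.
  have -> : d - ((1 - u) * c + u * ((1 - t) * c + t * d)) =
            (1 - u * t) * (d - c) by ring.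
  by rewrite mulf_eq0 !subr_eq0 eq_sym (negPf u1) /= => /eqP.
have e1 := bE _ _ (congr1 fst eb); have e2 := bE _ _ (congr1 snd eb).
by rewrite e1 e2; case: (b) => b1 b2 /=; congr pair; ring.
Qed.

(** * Graphs drawn by segments *)

Definition edge_rel S W x y : Prop :=
  [/\ x \in W, y \in W, x != y,
      exists2 s : plane * plane, s \in S & segment x y `<=` segment s.1 s.2 &
      forall z, z \in W -> segment x y z -> z = x \/ z = y].

(** The set of corners of a tiling is replaced by an arbitrary finite set
    W, so that a point can be added to the vertices without changing the tiles. *)
Definition edge_set S W : {fset {fset plane}} :=
  [fset e in fpowerset W |
     `[< exists x y, edge_rel S W x y /\ e = [fset x; y]%fset >]]%fset.

Lemma edge_setP S W (e : {fset plane}) :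
  reflect (exists x y, edge_rel S W x y /\ e = [fset x; y]%fset)
          (e \in edge_set S W).
Proof.
apply: (iffP idP); first by rewrite !inE => /andP[_ /asboolP].
move=> h; rewrite !inE; apply/andP; split; last exact/asboolP.
case: h => x [y [[xW yW _ _ _] ->]]; rewrite fpowersetE.
by apply/fsubsetP => z; rewrite !inE => /orP[] /eqP->.
Qed.

Lemma edge_relC S W x y : edge_rel S W x y -> edge_rel S W y x.
Proof.
case=> xW yW xy [s sS ss] h; split=> //; first by rewrite eq_sym.
  by exists s => //; rewrite segmentC.
by move=> z zW; rewrite segmentC => /(h z zW)[]; [right|left].
Qed.

Lemma fset2_inj x y x' y' : [fset x; y]%fset = [fset x'; y']%fset ->
  (x = x' /\ y = y') \/ (x = y' /\ y = x').
Proof.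
move=> e.
have := fset21 x y; rewrite e !inE => /orP[] /eqP ex.
  have := fset22 x y; rewrite e !inE => /orP[] /eqP ey; last by left.
  by left; split=> //; have := fset22 x' y'; rewrite -e !inE ex ey orbb => /eqP.
have := fset22 x y; rewrite e !inE => /orP[] /eqP ey; first by right.
by right; split=> //; have := fset21 x' y'; rewrite -e !inE ex ey orbb => /eqP.
Qed.

Lemma edge_set2 S W x y :
  [fset x; y]%fset \in edge_set S W <-> edge_rel S W x y.
Proof.
split; last by move=> h; apply/edge_setP; exists x, y.
move=> /edge_setP[x' [y' [h /fset2_inj[][-> ->]]]] //; exact: edge_relC.
Qed.

(** * Invariance under affine injections *)

Definition affine f := forall a b t, f (lerp a b t) = lerp (f a) (f b) t.

Lemma segment_affine f a b : affine f ->
  segment (f a) (f b) = f @` segment a b.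
Proof.
move=> fA; rewrite eqEsubset; split=> [_ [t t01 ->]|_ [_ [t t01 ->] <-]].
  by exists (lerp a b t) => //; exists t.
by exists t => //; exact: fA.
Qed.

Definition map_side f (s : plane * plane) := (f s.1, f s.2).

Lemma edge_rel_affine f S W x y : affine f -> injective f ->
  edge_rel (map (map_side f) S) (f @` W)%fset (f x) (f y) <-> edge_rel S W x y.
Proof.
move=> fA fI.
have segf a b z : segment (f a) (f b) (f z) <-> segment a b z.
  by rewrite (segment_affine _ _ fA); split=> [[z' ? /fI<-]|] //; exists z.
split=> [[xW yW xy [s sS ss] h]|[xW yW xy [s sS ss] h]]; split.
- by move: xW => /imfsetP[z /= zW /fI->].
- by move: yW => /imfsetP[z /= zW /fI->].
- by apply: contra_neq xy => ->.
- case/mapP: sS ss => s' s'S -> ss; exists s' => // z /segf/ss /=.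
  by move/segf.
- move=> z zW /segf/h; rewrite in_imfset// => /(_ isT)[] /fI; tauto.
- by rewrite in_imfset.
- by rewrite in_imfset.
- by apply: contra_neq xy => /fI.
- exists (map_side f s); first exact: map_f.
  rewrite !(segment_affine _ _ fA) => _ [z zs <-]; exists z => //; exact: ss.
- move=> _ /imfsetP[z /= zW ->] /segf/(h _ zW)[]->; tauto.
Qed.

Lemma card_edge_set_affine f S W : affine f -> injective f ->
  #|` edge_set (map (map_side f) S) (f @` W)%fset| = #|` edge_set S W|.
Proof.
move=> fA fI.
pose F (e : {fset plane}) := (f @` e)%fset.
have F2 x y : F [fset x; y]%fset = [fset f x; f y]%fset.
  exact: imfset_fset2.
have FI : injective F.
  move=> e e' eq; apply/fsetP => z.
  have mF d : (f z \in F d) = (z \in d) by rewrite /F mem_imfset.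
  by rewrite -!mF eq.
transitivity #|` F @` edge_set S W|%fset; last exact: card_imfset.
congr (#|` _ |).
apply/fsetP => e; apply/edge_setP/imfsetP.
  move=> [x [y [h ->]]].
  have [/imfsetP[x' /= _ xE] /imfsetP[y' /= _ yE] _ _ _] := h.
  exists [fset x'; y']%fset; last by rewrite F2 xE yE.
  by apply/edge_set2/(edge_rel_affine _ _ _ _ fA fI); rewrite -xE -yE.
move=> [e' /= /edge_setP[x [y [h ->]]] ->].
by exists (f x), (f y); split=> //; exact/edge_rel_affine.
Qed.

(** * Gluing and subdividing *)

(** A side lying in H1 has all its vertices in W1, because the points of W2
    that H1 contains are already in W1; so the union has on that side exactly
    the edges of the first graph. *)
Lemma edge_set_glue S1 S2 W1 W2 (H1 H2 : set plane) :
  (forall s, s \in S1 -> segment s.1 s.2 `<=` H1) ->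
  (forall s, s \in S2 -> segment s.1 s.2 `<=` H2) ->
  (forall z, z \in W2 -> H1 z -> z \in W1) ->
  (forall z, z \in W1 -> H2 z -> z \in W2) ->
  edge_set (S1 ++ S2) (W1 `|` W2)%fset =
    (edge_set S1 W1 `|` edge_set S2 W2)%fset.
Proof.
move=> SH1 SH2 WH1 WH2.
apply/fsetP => e; rewrite in_fsetU; apply/edge_setP/orP.
  move=> [x [y [[xW yW xy [s sS ss] h] ->]]].
  move: sS; rewrite mem_cat => /orP[sS|sS]; [left|right];
    apply/edge_set2; (split=> //; last by
      move=> z zW; apply: h; rewrite in_fsetU zW ?orbT); try by exists s.
  - move: xW; rewrite in_fsetU => /orP[//|/WH1]; apply.
    by apply: (SH1 s sS); apply: ss; exact: segment_l.
  - move: yW; rewrite in_fsetU => /orP[//|/WH1]; apply.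
    by apply: (SH1 s sS); apply: ss; exact: segment_r.
  - move: xW; rewrite in_fsetU => /orP[/WH2|//]; apply.
    by apply: (SH2 s sS); apply: ss; exact: segment_l.
  - move: yW; rewrite in_fsetU => /orP[/WH2|//]; apply.
    by apply: (SH2 s sS); apply: ss; exact: segment_r.
case=> /edge_setP[x [y [[xW yW xy [s sS ss] h] ->]]]; exists x, y; split=> //;
  split; rewrite ?in_fsetU ?xW ?yW ?orbT //.
- by exists s => //; rewrite mem_cat sS.
- move=> z; rewrite in_fsetU => /orP[/h//|zW zs]; apply: h => //.
  by apply: WH1 => //; apply: (SH1 s sS); exact: ss.
- by exists s => //; rewrite mem_cat sS orbT.
- move=> z; rewrite in_fsetU => /orP[zW zs|/h//]; apply: h => //.
  by apply: WH2 => //; apply: (SH2 s sS); exact: ss.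
Qed.

(** The edge ab is replaced by aw and wb.  The last hypothesis says that w is on
    no other edge; it also excludes new edges that would start at w and leave
    the segment ab. *)
Lemma card_edge_set_subdivide S W a b w :
  w \notin W -> edge_rel S W a b -> segment a b w ->
  (forall s, s \in S -> segment s.1 s.2 w ->
     forall y, y \in W -> segment s.1 s.2 y -> y = a \/ y = b) ->
  #|` edge_set S (w |` W)%fset| = #|` edge_set S W|.+1.
Proof.
move=> wW ab abw hw.
have [aW bW aNb [s0 s0S ss0] hab] := ab.
have neq x : x \in W -> x != w by move=> xW; apply: contraNneq wW => <-.
have half a' b' : edge_rel S W a' b' -> segment a' b' w ->
    edge_rel S (w |` W)%fset a' w.
  move=> [aW' bW' aNb' [s sS ss] h] abw'.
  split; rewrite ?fset1U1 ?neq ?in_fsetU ?aW' ?orbT //.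
    exists s => //; apply: subset_trans ss.
    by apply: sub_segment => //; exact: segment_l.
  move=> z; rewrite in_fsetU in_fset1 => /orP[/eqP-> _|zW zs]; first by right.
  have zab : segment a' b' z.
    by apply: sub_segment zs => //; exact: segment_l.
  case: (h z zW zab) => ez; [by left|right].
  rewrite ez in zs *; by rewrite (segment_antisym abw' zs).
have -> : edge_set S (w |` W)%fset =
   ([fset a; w] |` ([fset b; w] |` (edge_set S W `\ [fset a; b])))%fset.
  apply/fsetP => e; rewrite !in_fsetU !in_fsetD !in_fset1.
  apply/idP/idP.
    move=> /edge_setP[x [y [[xW yW xy [s sS ss] h] ->]]].
    have end_at z : z \in W -> segment x y z -> segment x y w ->
        z = a \/ z = b.
      by move=> zW zs wsg; apply: (hw s sS) => //; exact: ss.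
    have {}xW : x = w \/ x \in W.
      by move: xW; rewrite in_fsetU in_fset1 => /orP[/eqP|]; [left|right].
    have {}yW : y = w \/ y \in W.
      by move: yW; rewrite in_fsetU in_fset1 => /orP[/eqP|]; [left|right].
    case: xW => [ex|xW].
      subst x; case: yW => [ey|yW]; first by rewrite ey eqxx in xy.
      case: (end_at y yW (segment_r _ _) (segment_l _ _)) => ->.
        by rewrite [[fset w; a]%fset]fsetUC eqxx.
      by rewrite [[fset w; b]%fset]fsetUC eqxx orbT.
    case: yW => [ey|yW].
      subst y; case: (end_at x xW (segment_l _ _) (segment_r _ _)) => ->.
        by rewrite eqxx.
      by rewrite eqxx orbT.
    have wxy : ~ segment x y w.
      by move=> wxy; case: (h w (fset1U1 _ _) wxy) => ew;
        move: wW; rewrite ew ?xW ?yW.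
    apply/orP; right; apply/orP; right; apply/andP; split.
      apply/eqP => /fset2_inj[][ex ey]; apply: wxy; rewrite ex ey //.
      by rewrite segmentC.
    apply/edge_set2; split=> //; first by exists s.
    by move=> z zW; apply: h; rewrite in_fsetU zW orbT.
  move=> /orP[/eqP->|/orP[/eqP->|/andP[eab /edge_setP[x [y [h eE]]]]]].
  - by apply/edge_set2; exact: half ab abw.
  - apply/edge_set2; apply: half (edge_relC ab) _; by rewrite segmentC.
  - rewrite eE; apply/edge_set2; have [xW yW xy [s sS ss] hz] := h.
    split; rewrite ?in_fsetU ?xW ?yW ?orbT //; first by exists s.
    move=> z; rewrite in_fsetU in_fset1 => /orP[/eqP-> wxy|]; last exact: hz.
    have ends v : v \in W -> segment x y v -> v = a \/ v = b.
      by move=> vW vs; apply: (hw s sS) => //; exact: ss.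
    case/negP: eab; rewrite eE.
    case: (ends x xW (segment_l _ _)) => ex;
      case: (ends y yW (segment_r _ _)) => ey; subst x y;
      rewrite ?eqxx // in xy *.
    by rewrite fsetUC.
have wNe x e : e \in edge_set S W -> e != [fset x; w]%fset.
  move=> /edge_setP[x' [y' [[xW yW _ _ _] ->]]].
  apply/eqP => E; move: (fset22 x w); rewrite -E !inE => /orP[] /eqP ew;
    by move: wW; rewrite ew ?xW ?yW.
rewrite !cardfsU1 !in_fsetU !in_fsetD !in_fset1.
have abE : [fset a; b]%fset \in edge_set S W by exact/edge_set2.
have nE x : ([fset x; w]%fset \in edge_set S W) = false.
  by apply/negP => /(wNe x); rewrite eqxx.
rewrite !nE !andbF !orbF /=.
have -> : ([fset a; w]%fset == [fset b; w]%fset) = false.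
  apply/eqP => /fset2_inj[][ea eb].
    by move: aNb; rewrite ea eqxx.
  by move: wW; rewrite -ea aW.
by rewrite (cardfsD1 [fset a; b]%fset (edge_set S W)) abE /= !add1n.
Qed.

End PlanarGraphs.

(** * Counting edges *)

Lemma card_fset_count (T : choiceType) (A : {fset T}) (P : pred T) :
  #|` [fset x in A | P x]%fset| = count P A.
Proof.
rewrite -size_filter; apply/perm_size/uniq_perm => [||x].
- exact: fset_uniq.
- exact/filter_uniq/fset_uniq.
- by rewrite mem_filter !inE andbC.
Qed.

(** The incidences between vertices and edges are counted in both orders. *)
Lemma handshake (T : choiceType) (W : {fset T}) (E : {fset {fset T}}) :
  (forall e, e \in E ->
     exists x y, [/\ x \in W, y \in W, x != y & e = [fset x; y]%fset]) ->
  (\sum_(v <- W) #|` [fset e in E | v \in e]%fset|)%N = (2 * #|` E|)%N.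
Proof.
move=> hE.
under eq_bigr => v _ do rewrite card_fset_count -sum1_count big_mkcond /=.
rewrite exchange_big /= mulnC -[X in (X * _)%N]sum1_size big_distrl /=.
rewrite big_seq [RHS]big_seq; apply: eq_bigr => e /hE[x [y [xW yW xy ->]]].
rewrite -big_mkcond sum1_count -card_fset_count mul1n.
transitivity #|` [fset x; y]%fset|; last by rewrite cardfs2 xy.
congr (#|` _ |); apply/fsetP => z; rewrite !inE.
by case: eqP => [->|]; case: eqP => [->|]; rewrite ?xW ?yW ?andbF.
Qed.

Section Consecutive.
Variables (R : realType) (T : choiceType) (j : R -> T).

Lemma seq_least (s : seq R) (P : pred R) : has P s ->
  exists m, [/\ m \in s, P m & forall c, c \in s -> P c -> m <= c].
Proof.
elim: s => //= a s IH.
have [Ps _|Ps] := boolP (has P s).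
  have [m [ms Pm mmin]] := IH Ps.
  have [/andP[am Pa]|h] := boolP ((a <= m) && P a).
    exists a; split; rewrite ?mem_head // => c; rewrite inE => /orP[/eqP->//|cs Pc].
    exact: le_trans am (mmin c cs Pc).
  exists m; split; rewrite ?inE ?ms ?orbT // => c /orP[/eqP-> Pa|]; last exact: mmin.
  by move: h; rewrite Pa andbT -ltNge => /ltW.
rewrite orbF => Pa; exists a; split; rewrite ?mem_head // => c.
by rewrite inE => /orP[/eqP->//|cs Pc]; case/hasP: Ps; exists c.
Qed.

(** Every point of G except the largest one is the left end of exactly one edge,
    the one that joins it to its successor. *)
Lemma card_consecutive (G : {fset R}) (E : {fset {fset T}}) :
  {in G &, injective j} -> G != fset0 ->
  (forall e, e \in E <-> exists a b, [/\ a \in G, b \in G, a < b,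
      forall c, c \in G -> a < c -> b <= c & e = [fset j a; j b]%fset]) ->
  #|` E|.+1 = #|` G|.
Proof.
move=> jI /fset0Pn[x0 x0G] hE.
have [M [MG Mmax]] : exists M, M \in G /\ forall c, c \in G -> c <= M.
  have /seq_least[m [/mapP[M MG ->] _ h]] : has predT [seq - x | x <- G].
    by apply/hasP; exists (- x0) => //; exact: map_f.
  by exists M; split => // c cG; rewrite -lerN2; apply: h => //; exact: map_f.
pose next a := xget 0 [set b | [/\ b \in G, a < b &
                                 forall c, c \in G -> a < c -> b <= c]].
have nextP a : a \in G -> a != M -> [/\ next a \in G, a < next a &
    forall c, c \in G -> a < c -> next a <= c].
  move=> aG aM; rewrite /next; case: xgetP => [b -> []//|none].
  have /seq_least[m [mG am mmin]] : has (> a) G.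
    by apply/hasP; exists M => //; rewrite lt_neqAle aM Mmax.
  by case: (none m).
have -> : E = [fset [fset j a; j (next a)]%fset | a in (G `\ M)%fset]%fset.
  apply/fsetP => e; apply/idP/imfsetP.
    move=> /hE[a [b [aG bG ab abmin ->]]].
    have aM : a != M by apply: contraTneq ab => ->; rewrite -leNgt Mmax.
    exists a; first by rewrite !inE aM.
    have [nG an nmin] := nextP a aG aM.
    suff -> : next a = b by [].
    by apply/le_anti; rewrite nmin //= abmin.
  move=> [a /=]; rewrite !inE => /andP[aM aG] ->; apply/hE.
  by have [nG an nmin] := nextP a aG aM; exists a, (next a); split.
rewrite card_in_imfset /=; last first.
  move=> a b; rewrite !inE => /andP[aM aG] /andP[bM bG].
  have [naG an amin] := nextP a aG aM; have [nbG bn bmin] := nextP b bG bM.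
  move=> e; have := fset21 (j a) (j (next a)).
  rewrite e !inE => /orP[] /eqP /jI; first exact.
  move=> /(_ aG nbG) ea; have := fset21 (j b) (j (next b)).
  rewrite -e !inE => /orP[] /eqP /jI; first by move=> ->.
  by move=> /(_ bG naG) eb; move: bn an; rewrite -ea -eb => /lt_trans h /h; rewrite ltxx.
by rewrite (cardfsD1 M G) MG.
Qed.

End Consecutive.

(** * The rescaled substitution *)

Section Ammann.
Variables (R : realType) (t : R).
Hypotheses (t_gt0 : 0 < t) (tt : t * t = 1 - t).
Local Notation plane := (R * R)%type.
Implicit Types (p q z : plane) (u v x r : R) (n i : nat).

Lemma t_lt1 : t < 1.
Proof. by have := mulr_gt0 t_gt0 t_gt0; rewrite tt subr_gt0. Qed.

Lemma t_gt_half : 2 * t > 1.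
Proof.
have : 0 < t * (1 - t) by rewrite mulr_gt0 ?subr_gt0 ?t_lt1.
by rewrite mulrBr mulr1 tt; lra.
Qed.

Lemma t_scale x : 0 <= x <= 1 -> 0 <= t * x <= t.
Proof. by move=> ?; have := t_gt0; nra. Qed.

(** These are f1 and f2 in the coordinates x and y / Psi. *)
Definition g1 p : plane := (1 - t * p.2, p.1).
Definition g2 p : plane := (t - t * p.1, t * p.2).

Definition hexagon1 : seq plane :=
  [:: (0, 0); (1, 0); (1, 1); (1 - t, 1); (1 - t, t); (0, t)].

(** Tiles are kept as lists of corners, generation n + 1 having index n.  Reading
    the substitution as a two-step recurrence makes their kinds disappear. *)
Fixpoint hexes n : seq (seq plane) :=
  if n is n'.+1 then
    if n' is n''.+1 then
      map (map g1) (hexes n') ++ map (map g2) (hexes n'')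
    else [:: hexagon1]
  else [:: hexagon1].

Definition polygon_sides (c : seq plane) := zip c (rot 1 c).
Definition patchV n : {fset plane} := [fset p in flatten (hexes n)]%fset.
Definition patchS n := flatten (map polygon_sides (hexes n)).
Definition patchE n := edge_set (patchS n) (patchV n).

Lemma g1_inj : injective g1.
Proof.
move=> [x y] [x' y'] [/=]; move=> e ->; congr pair.
by apply: (mulfI (lt0r_neq0 t_gt0)); lra.
Qed.

Lemma g2_inj : injective g2.
Proof.
move=> [x y] [x' y'] [/= e1 e2].
by congr pair; apply: (mulfI (lt0r_neq0 t_gt0)); lra.
Qed.

Lemma g1_affine : affine g1.
Proof. by move=> [x y] [x' y'] u; rewrite /g1 /lerp /=; congr pair; ring. Qed.

Lemma g2_affine : affine g2.
Proof. by move=> [x y] [x' y'] u; rewrite /g2 /lerp /=; congr pair; ring. Qed.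

Lemma polygon_sides_map f c :
  polygon_sides (map f c) = map (map_side f) (polygon_sides c).
Proof.
rewrite /polygon_sides -map_rot; elim: c (rot 1 c) => [|a c IH] [|b d] //=.
by rewrite IH.
Qed.

Lemma patchS_step n :
  patchS n.+2 = map (map_side g1) (patchS n.+1) ++ map (map_side g2) (patchS n).
Proof.
rewrite /patchS [hexes n.+2]/= map_cat flatten_cat !map_flatten -!map_comp.
by congr (flatten _ ++ flatten _); apply: eq_map => c /=;
  rewrite polygon_sides_map.
Qed.

Lemma patchV_step n : patchV n.+2 = (g1 @` patchV n.+1 `|` g2 @` patchV n)%fset.
Proof.
apply/fsetP => z.
rewrite in_fsetU /patchV [hexes n.+2]/= in_fset /= flatten_cat mem_cat.
rewrite -!map_flatten; congr orb; apply/mapP/imfsetP => -[p pV ->];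
  exists p => //; by move: pV; rewrite !inE.
Qed.

(** * The boundary of the hexagon *)

(** The sides of the hexagon, numbered so that side i of a generation repeats the
    bottom of i generations before: bottom, right, top, left, then the horizontal
    and the vertical side of the notch.  The orientations are chosen to make the
    parameters agree in this repetition. *)
Definition side i u : plane :=
  match i with
  | 0 => (u, 0)
  | 1 => (1, u)
  | 2 => (1 - t * u, 1)
  | 3 => (0, t * u)
  | 4 => ((1 - t) * u, t)
  | _ => (1 - t, t + (1 - t) * u)
  end.

(** The bottom side is cut at t: [0, t] is the reversed bottom side of the small
    part and [t, 1] is the reversed left side of the large part. *)
Definition subdivide (A B : {fset R}) : {fset R} :=
  ((fun x => t - t * x) @` A `|` (fun x => 1 - (1 - t) * x) @` B)%fset.

(** The left side repeats the bottom of three generations before, and the large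
    part is itself one generation older: hence the jump from m + 2 to m - 2.
    Indices below 2 all stand for a bare hexagon, so truncating the subtraction
    at 0 gives the right sets. *)
Fixpoint marks n : {fset R} :=
  (if n is n'.+1 then
    if n' is m.+1 then subdivide (marks m) (if m is k.+2 then marks k else [fset 0; 1])
    else [fset 0; 1]
  else [fset 0; 1])%fset.

Lemma marks_step m : marks m.+2 =
  ((fun x => t - t * x) @` marks m `|`
   (fun x => 1 - (1 - t) * x) @` marks (m - 2))%fset.
Proof. by case: m => [|[|m]]; rewrite ?subSS ?subn0. Qed.

Lemma marks_ends m : (0 \in marks m) && (1 \in marks m).
Proof.
elim/ltn_ind: m => -[|[|m]] IH; rewrite ?marks_step !inE ?eqxx ?orbT //.
have /andP[b0 b1] := IH m (leqnSn _).
have /andP[b0' _] := IH (m - 2)%N (leq_trans (leq_subr _ _) (leqnSn _)).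
apply/andP; split; apply/orP.
  by left; apply/imfsetP; exists 1 => //=; rewrite mulr1 subrr.
by right; apply/imfsetP; exists 0 => //=; rewrite mulr0 subr0.
Qed.

Lemma marks0 m : 0 \in marks m. Proof. by case/andP: (marks_ends m). Qed.
Lemma marks1 m : 1 \in marks m. Proof. by case/andP: (marks_ends m). Qed.

Lemma marks_itv m u : u \in marks m -> 0 <= u <= 1.
Proof.
elim/ltn_ind: m u => -[|[|m]] IH u; rewrite ?marks_step !inE.
- by case/orP => /eqP->; lra.
- by case/orP => /eqP->; lra.
have t1 := t_lt1.
move=> /orP[] /imfsetP[x /= xB ->].
  have /IH/(_ x xB)/t_scale : (m < m.+2)%N by []; lra.
have /IH/(_ x xB) : (m - 2 < m.+2)%N by lia.
have := t_gt0; nra.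
Qed.

Lemma marks_small m u : (m < 2)%N -> (u \in marks m) = (u == 0) || (u == 1).
Proof. by case: m => [|[|m]] // _; rewrite !inE. Qed.

Lemma marks_low m u : 0 <= u <= 1 -> (t - t * u \in marks m.+2) = (u \in marks m).
Proof.
move=> u01; have t0 := t_gt0; have t1 := t_lt1; have tu := t_scale u01.
rewrite marks_step in_fsetU; apply/orP/idP; last first.
  by move=> uB; left; apply/imfsetP; exists u.
case=> /imfsetP[x /= xB e].
  suff -> : u = x by [].
  by apply: (mulfI (lt0r_neq0 t_gt0)); lra.
have x01 := marks_itv xB.
suff -> : u = 0 by exact: marks0.
have := t_scale x01; nra.
Qed.

Lemma marks_high m u : 0 <= u <= 1 ->
  (1 - (1 - t) * u \in marks m.+2) = (u \in marks (m - 2)).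
Proof.
move=> u01; have t0 := t_gt0; have t1 := t_lt1; have tu := t_scale u01.
rewrite marks_step in_fsetU; apply/orP/idP; last first.
  by move=> uB; right; apply/imfsetP; exists u.
case=> /imfsetP[x /= xB e].
  suff -> : u = 1 by exact: marks1.
  have := t_scale (marks_itv xB); nra.
suff -> : u = x by [].
have nz : 1 - t != 0 by lra.
by apply: (mulfI nz); lra.
Qed.

(** The extra case u = 0 takes care of indices m < 2, where t is not a mark. *)
Lemma marks_low_trunc m u : 0 <= u <= 1 ->
  (t - t * u \in marks m) || (u == 0) = (u \in marks (m - 2)).
Proof.
move=> u01; have t0 := t_gt0; have t1 := t_lt1; have tu := t_scale u01.
case: m => [|[|m]]; last first.
  rewrite marks_low // subSS subSS subn0 orb_idr // => /eqP->; exact: marks0.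
all: rewrite !marks_small // orbC; congr orb; apply/orP/eqP;
  [move=> [] /eqP e; nra | move=> ->; left; apply/eqP; ring].
Qed.

(** The extra case u = 1 takes care of indices m < 2, where t is not a mark. *)
Lemma marks_high_trunc m u : 0 <= u <= 1 ->
  (1 - (1 - t) * u \in marks m) || (u == 1) = (u \in marks (m - 4)).
Proof.
move=> u01; have t0 := t_gt0; have t1 := t_lt1; have tu := t_scale u01.
case: m => [|[|m]]; last first.
  rewrite marks_high // (_ : (m.+2 - 4 = m - 2)%N); last lia.
  by rewrite orb_idr // => /eqP->; exact: marks1.
all: rewrite !marks_small //; congr orb; apply/orP/eqP;
  [move=> [] /eqP e; nra | move=> ->; right; apply/eqP; ring].
Qed.

(** The closed hexagon: the unit square without its upper left notch. *)
Definition region p : Prop :=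
  [/\ 0 <= p.1 <= 1, 0 <= p.2 <= 1 & (p.2 <= t) || (1 - t <= p.1)].

Lemma region_g1 p : region p -> region (g1 p).
Proof.
case: p => x y [/= x01 y01 h]; have := t_scale y01; have t1 := t_lt1.
by split => /=; [lra|lra|apply/orP; right; lra].
Qed.

Lemma region_g2 p : region p -> region (g2 p).
Proof.
case: p => x y [/= x01 y01 h]; have := t_scale y01; have := t_scale x01.
by have t1 := t_lt1; split => /=; [lra|lra|apply/orP; left; lra].
Qed.

Lemma region_side i u : 0 <= u <= 1 -> region (side i u).
Proof.
move=> u01; have tu := t_scale u01; have t2 := t_gt_half; have t1 := t_lt1.
have ? : 0 <= (1 - t) * u <= 1 - t by nra.
have t0 := t_gt0.
by case: i => [|[|[|[|[|i]]]]]; split => /=; try lra; apply/orP;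
  try (by left; lra); right; lra.
Qed.

Lemma side_affine i u v x :
  side i ((1 - x) * u + x * v) = lerp (side i u) (side i v) x.
Proof.
by case: i => [|[|[|[|[|i]]]]]; rewrite /side /lerp /=; congr pair; ring.
Qed.

(** The large part provides the right side, the top, the vertical side of the
    notch and the right end of the bottom. *)
Lemma g1_sides u :
  [/\ g1 (side 0 u) = side 1 u, g1 (side 1 u) = side 2 u,
      g1 (side 2 (t - t * u)) = side 5 u &
      g1 (side 3 u) = side 0 (1 - (1 - t) * u)].
Proof. by rewrite -tt; split; rewrite /g1 /side /=; congr pair; ring: tt. Qed.

(** The small part provides the left end of the bottom, the left side and the
    horizontal side of the notch. *)
Lemma g2_sides u :
  [/\ g2 (side 0 u) = side 0 (t - t * u), g2 (side 1 u) = side 3 u &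
      g2 (side 2 u) = side 4 u].
Proof. by split; rewrite /g2 /side /=; congr pair; ring: tt. Qed.

(** The two descriptions of the seam use the same parameter, which is why the
    vertices on it will match. *)
Lemma interface_sides u :
  [/\ g2 (side 3 u) = g1 (side 4 u), g2 (side 4 u) = g1 (side 5 u) &
      g2 (side 5 u) = g1 (side 2 (1 - (1 - t) * u))].
Proof. by split; rewrite /g1 /g2 /side /=; congr pair; ring: tt. Qed.

(** * Vertices on the boundary *)

Lemma patchV_region n p : p \in patchV n -> region p.
Proof.
elim/ltn_ind: n p => -[|[|n]] IH p; last first.
  rewrite patchV_step in_fsetU => /orP[] /imfsetP[q /= qV ->].
    exact/region_g1/(IH n.+1).
  exact/region_g2/(IH n).
all: have t0 := t_gt0; have t1 := t_lt1; have t2 := t_gt_half.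
all: have corner x y : (0 <= x <= 1) -> (0 <= y <= 1) ->
  (y <= t) || (1 - t <= x) -> region (x, y) by split.
all: rewrite /patchV /= !inE.
all: do 5![case/orP => [/eqP->|]; first by apply: corner; lra].
all: by rewrite ?orbF => /eqP->; apply: corner; lra.
Qed.

Lemma mem_g1 (X : {fset plane}) p : (g1 p \in g1 @` X)%fset = (p \in X).
Proof. by rewrite mem_imfset //; exact: g1_inj. Qed.

Lemma mem_g2 (X : {fset plane}) p : (g2 p \in g2 @` X)%fset = (p \in X).
Proof. by rewrite mem_imfset //; exact: g2_inj. Qed.

(** A point inside a side differs from each corner, by comparing coordinates. *)
Lemma side_hexagon n i u : (n < 2)%N -> (i < 6)%N -> 0 <= u <= 1 ->
  (side i u \in patchV n) = (u == 0) || (u == 1).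
Proof.
move=> n2 i6 u01; have t0 := t_gt0; have t1 := t_lt1; have t2 := t_gt_half.
have -> : (side i u \in patchV n) = (side i u \in hexagon1).
  by case: n n2 => [|[|n]] // _; rewrite /patchV /= in_fset /=.
apply/idP/orP; last first.
  case=> /eqP->; case: i i6 => [|[|[|[|[|[|i]]]]]] // _;
    rewrite /side ?mulr0 ?mulr1 ?subr0 ?addr0 ?subrK !inE ?eqxx ?orbT //.
  by rewrite [t + _]addrC subrK eqxx !orbT.
have [->|u0] := eqVneq u 0; first by left.
have [->|u1] := eqVneq u 1; first by right.
have ulo : 0 < u by lra.
have uhi : u < 1 by lra.
have tu : 0 < t * u < t by nra.
have tu' : 0 < (1 - t) * u < 1 - t by nra.
move=> h; exfalso; move: h.
by case: i i6 => [|[|[|[|[|[|i]]]]]] // _; rewrite /side !inE !xpair_eqE;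
  do 5![case/orP => [/andP[/eqP ? /eqP ?]|]; first by lra];
  case/andP => /eqP ? /eqP ?; lra.
Qed.

(** Each side comes from sides of the two preceding generations by [g1_sides] and
    [g2_sides].  The other part of the cut touches the side at most in a corner,
    and 0 and 1 are always marks. *)
Lemma side_vertex n i u : (i < 6)%N -> 0 <= u <= 1 ->
  (side i u \in patchV n) = (u \in marks (n - i)).
Proof.
elim/ltn_ind: n i u => -[|[|n]] IH i u i6 u01;
  try by rewrite side_hexagon // marks_small // ltnS leq_subr.
have t0 := t_gt0; have t1 := t_lt1; have t2 := t_gt_half.
have tu := t_scale u01; have tu' : 0 <= (1 - t) * u <= 1 - t by nra.
have IH1 j v := IH n.+1 (leqnn _) j v; have IH2 j v := IH n (leqnSn _) j v.
rewrite patchV_step in_fsetU.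
have img1 z : z \in (g1 @` patchV n.+1)%fset ->
    exists p, [/\ region p, p \in patchV n.+1 & z = g1 p].
  by case/imfsetP => p /= pV ->; exists p; split => //; exact: patchV_region pV.
have img2 z : z \in (g2 @` patchV n)%fset ->
    exists p, [/\ region p, p \in patchV n & z = g2 p].
  by case/imfsetP => p /= pV ->; exists p; split => //; exact: patchV_region pV.
case: i i6 => [|[|[|[|[|[|i]]]]]] // _.
- have [ut|ut] := leP u t.
    have u'01 : 0 <= 1 - u / t <= 1.
      by rewrite subr_ge0 ler_pdivrMr // mul1r ut /= lerBlDr lerDl divr_ge0; lra.
    have uE : u = t - t * (1 - u / t).
      by rewrite mulrBr mulr1 subKr mulrC divfK // lt0r_neq0.
    rewrite {2 3}uE; have [<- _ _] := g2_sides (1 - u / t).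
    rewrite mem_g2 IH2 // subn0 subn0 marks_low // orb_idl //.
    move=> /img1[p [[p1 p2 p3] _ [e1 e2]]].
    have {}p2 : p.2 <= t by case/orP: p3; lra.
    have : t * p.2 <= t * t by rewrite ler_pM2l.
    rewrite tt => ?; have -> : u = t by lra.
    by rewrite divff ?lt0r_neq0 // subrr marks0.
  have u'01 : 0 <= (1 - u) / (1 - t) <= 1.
    by rewrite ler_pdivrMr ?divr_ge0; lra.
  have uE : u = 1 - (1 - t) * ((1 - u) / (1 - t)).
    by rewrite [_ * (_ / _)]mulrC divfK ?subKr // lt0r_neq0 // subr_gt0.
  rewrite {1 3}uE; have [_ _ _ <-] := g1_sides ((1 - u) / (1 - t)).
  rewrite mem_g1 IH1 // subn0 marks_high // subSS.
  rewrite orb_idr // => /img2[p [[p1 p2 p3] _ [e1 e2]]].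
  by have := t_scale p1; lra.
- have [<- _ _ _] := g1_sides u; rewrite mem_g1 IH1 // subn0 subSS subn0.
  rewrite orb_idr // => /img2[p [[p1 p2 p3] _ [e1 e2]]].
  by have := t_scale p1; lra.
- have [_ <- _ _] := g1_sides u; rewrite mem_g1 IH1 //.
  rewrite orb_idr // => /img2[p [[p1 p2 p3] _ [e1 e2]]].
  by have := t_scale p2; lra.
- have [_ <- _] := g2_sides u; rewrite mem_g2 IH2 //.
  rewrite orb_idl // => /img1[p [[p1 p2 p3] _ [e1 e2]]].
  by have := t_scale p2; lra.
- have [_ _ <-] := g2_sides u; rewrite mem_g2 IH2 //.
  rewrite orb_idl // => /img1[p [[p1 p2 p3] _ [e1 e2]]].
  suff -> : u = 1 by exact: marks1.
  have {}e1 : (1 - t) * u = 1 - t * p.2 by rewrite -e1; ring: tt.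
  apply: (mulfI (lt0r_neq0 (_ : 0 < 1 - t))); first by rewrite subr_gt0.
  by have := t_scale p2; lra.
- have [_ _ <- _] := g1_sides u; rewrite mem_g1 IH1 //; last by lra.
  rewrite (_ : n.+2 - 5 = n.+1 - 2 - 2)%N -?(marks_low_trunc _ u01); last first.
    by rewrite -subnDA subSS.
  congr orb; apply/idP/eqP => [/img2[p [[p1 p2 p3] _ [e1 e2]]]|->].
    have {}e2 : t + (1 - t) * u = t * p.2 by rewrite -e2; ring: tt.
    apply: (mulfI (lt0r_neq0 (_ : 0 < 1 - t))); first by rewrite subr_gt0.
    by have := t_scale p2; lra.
  have -> : g1 (side 2 (t - t * 0)) = g2 (side 2 1).
    by have [_ _ -> _] := g1_sides 0; rewrite /g2 /side /=; congr pair; ring: tt.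
  by rewrite mem_g2 IH2 ?marks1 //; lra.
Qed.

(** * Sides of tiles along the boundary *)

Definition covered (L : seq (plane * plane)) p q :=
  exists2 s : plane * plane, s \in L &
  segment p q `<=` segment s.1 s.2.

Lemma covered_map f L p q : affine f ->
  covered L p q -> covered (map (map_side f) L) (f p) (f q).
Proof.
move=> fA [s sS ss]; exists (map_side f s); first exact: map_f.
by rewrite !(segment_affine _ _ fA) => _ [z /ss zs <-]; exists z.
Qed.

Lemma covered_g1 n p q : covered (patchS n.+1) p q -> covered (patchS n.+2) (g1 p) (g1 q).
Proof.
move=> /(covered_map g1_affine)[s sS ss]; exists s => //.
by rewrite patchS_step mem_cat sS.
Qed.

Lemma covered_g2 n p q : covered (patchS n) p q -> covered (patchS n.+2) (g2 p) (g2 q).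
Proof.
move=> /(covered_map g2_affine)[s sS ss]; exists s => //.
by rewrite patchS_step mem_cat sS orbT.
Qed.

(** No element of B lies strictly between u and v, in either order; the order
    matters because some of the maps between sides reverse it. *)
Definition gap (B : {fset R}) u v :=
  forall r, r \in B -> r <= u /\ r <= v \/ u <= r /\ v <= r.

Lemma gap_low m u v : 0 <= u <= 1 -> 0 <= v <= 1 ->
  gap (marks (m - 2)) u v -> gap (marks m) (t - t * u) (t - t * v).
Proof.
move=> u01 v01 h r rB; have t0 := t_gt0; have t1 := t_lt1.
have := t_scale u01; have := t_scale v01.
have [rt|rt] := leP r t; last by right; lra.
have r01 := marks_itv rB.
have rE : r = t - t * (1 - r / t).
  by rewrite mulrBr mulr1 subKr mulrC divfK // lt0r_neq0.
set r' := 1 - r / t in rE.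
have r'01 : 0 <= r' <= 1.
  by rewrite subr_ge0 ler_pdivrMr // mul1r rt /= lerBlDr lerDl divr_ge0; lra.
have /h : r' \in marks (m - 2) by rewrite -marks_low_trunc // -rE rB.
by rewrite rE !lerD2l !lerN2 !ler_pM2l //; tauto.
Qed.

Lemma gap_high m u v : 0 <= u <= 1 -> 0 <= v <= 1 ->
  gap (marks (m - 4)) u v ->
  gap (marks m) (1 - (1 - t) * u) (1 - (1 - t) * v).
Proof.
move=> u01 v01 h r rB; have t0 := t_gt0; have t1 : 0 < 1 - t by rewrite subr_gt0 t_lt1.
have ? : (1 - t) * u <= 1 - t by nra.
have ? : (1 - t) * v <= 1 - t by nra.
have [tr|tr] := leP t r; last by left; lra.
have r01 := marks_itv rB.
have rE : r = 1 - (1 - t) * ((1 - r) / (1 - t)).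
  by rewrite [_ * (_ / _)]mulrC divfK ?subKr // lt0r_neq0.
set r' := (1 - r) / _ in rE.
have r'01 : 0 <= r' <= 1 by rewrite ler_pdivrMr ?divr_ge0; lra.
have /h : r' \in marks (m - 4) by rewrite -marks_high_trunc // -rE rB.
by rewrite rE !lerD2l !lerN2 !ler_pM2l //; tauto.
Qed.

Lemma gap_low_conv m u v :
  gap (marks m.+2) (t - t * u) (t - t * v) -> gap (marks m) u v.
Proof.
move=> h r rB; have r01 := marks_itv rB.
have /h : t - t * r \in marks m.+2 by rewrite marks_low.
by rewrite !lerD2l !lerN2 !ler_pM2l //; tauto.
Qed.

Lemma gap_high_conv m u v :
  gap (marks m.+2) (1 - (1 - t) * u) (1 - (1 - t) * v) ->
  gap (marks (m - 2)) u v.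
Proof.
move=> h r rB; have r01 := marks_itv rB; have t1 := t_lt1.
have /h : 1 - (1 - t) * r \in marks m.+2 by rewrite marks_high.
by rewrite !lerD2l !lerN2 !ler_pM2l ?subr_gt0 //; tauto.
Qed.

Lemma side_cover_hexagon n i u v : (n < 2)%N -> (i < 6)%N ->
  0 <= u <= 1 -> 0 <= v <= 1 -> covered (patchS n) (side i u) (side i v).
Proof.
move=> n2 i6 u01 v01.
have in_side x : 0 <= x <= 1 -> segment (side i 0) (side i 1) (side i x).
  move=> x01; exists x => //; rewrite -[RHS]/(lerp _ _ _) -side_affine.
  by congr side; ring.
suff [s sS sE] : covered (patchS n) (side i 0) (side i 1).
  by exists s => //; apply: subset_trans sE; apply: sub_segment; exact: in_side.
have -> : patchS n = polygon_sides hexagon1 by case: n n2 => [|[]].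
have sub a b : (a, b) \in polygon_sides hexagon1 ->
    covered (polygon_sides hexagon1) a b by move=> h; exists (a, b).
have subC a b : (b, a) \in polygon_sides hexagon1 ->
    covered (polygon_sides hexagon1) a b.
  by move=> h; exists (b, a) => //=; rewrite segmentC.
have e2 : t + (1 - t) = 1 by ring.
case: i i6 in_side => [|[|[|[|[|[|i]]]]]] // _ _; rewrite /side;
  rewrite ?mulr0 ?mulr1 ?subr0 ?addr0 ?e2;
  first [ by apply: sub; rewrite !inE !eqxx ?orbT
        | by apply: subC; rewrite !inE !eqxx ?orbT ].
Qed.

(** The bottom side is cut at the vertex t, so a gap lies in one of its two
    pieces; every other side is copied from a side of a previous generation.
    The ends u and v need not be marks: for small n the vertical side of the
    notch is only a part of the top of the large part. *)
Lemma side_cover n i u v : (i < 6)%N -> 0 <= u <= 1 -> 0 <= v <= 1 ->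
  gap (marks (n - i)) u v -> covered (patchS n) (side i u) (side i v).
Proof.
elim/ltn_ind: n i u v => -[|[|n]] IH i u v i6 u01 v01;
  try by move=> _; exact: side_cover_hexagon.
have IH1 j x y := IH n.+1 (leqnn _) j x y.
have IH2 j x y := IH n (leqnSn _) j x y.
have t0 := t_gt0; have t1 : 0 < 1 - t by rewrite subr_gt0 t_lt1.
case: i i6 => [|[|[|[|[|[|i]]]]]] // _.
- rewrite subn0 => h.
  have low x : x <= t -> x = t - t * (1 - x / t).
    by rewrite mulrBr mulr1 subKr mulrC divfK // lt0r_neq0.
  have low01 x : 0 <= x <= 1 -> x <= t -> 0 <= 1 - x / t <= 1.
    move=> ? xt; rewrite subr_ge0 ler_pdivrMr // mul1r xt /= lerBlDr lerDl.
    by rewrite divr_ge0; lra.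
  have high x : t <= x -> x = 1 - (1 - t) * ((1 - x) / (1 - t)).
    by rewrite [_ * (_ / _)]mulrC divfK ?subKr // lt0r_neq0.
  have high01 x : 0 <= x <= 1 -> t <= x -> 0 <= (1 - x) / (1 - t) <= 1.
    by move=> ? xt; rewrite ler_pdivrMr ?divr_ge0; lra.
  have /h[[tu tv]|[ut vt]] : t \in marks n.+2.
    by rewrite -[X in X \in _]subr0 -[X in _ - X](mulr0 t) marks_low ?marks0 //; lra.
  + have u'01 := high01 u u01 tu; have v'01 := high01 v v01 tv.
    have uE := high u tu; have vE := high v tv.
    move: h; rewrite uE vE => /gap_high_conv h.
    have [_ _ _ <-] := g1_sides ((1 - u) / (1 - t)).
    have [_ _ _ <-] := g1_sides ((1 - v) / (1 - t)).
    by apply: covered_g1; apply: IH1 => //; rewrite subSS.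
  + have u'01 := low01 u u01 ut; have v'01 := low01 v v01 vt.
    have uE := low u ut; have vE := low v vt.
    move: h; rewrite uE vE => /gap_low_conv h.
    have [<- _ _] := g2_sides (1 - u / t); have [<- _ _] := g2_sides (1 - v / t).
    by apply: covered_g2; apply: IH2 => //; rewrite subn0.
- rewrite subSS => h.
  have [<- _ _ _] := g1_sides u; have [<- _ _ _] := g1_sides v.
  by apply: covered_g1; apply: IH1.
- rewrite subSS => h.
  have [_ <- _ _] := g1_sides u; have [_ <- _ _] := g1_sides v.
  by apply: covered_g1; apply: IH1.
- rewrite !subSS => h.
  have [_ <- _] := g2_sides u; have [_ <- _] := g2_sides v.
  by apply: covered_g2; apply: IH2.
- rewrite !subSS => h.
  have [_ _ <-] := g2_sides u; have [_ _ <-] := g2_sides v.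
  by apply: covered_g2; apply: IH2.
- rewrite (_ : n.+2 - 5 = n.+1 - 2 - 2)%N; last by rewrite -subnDA subSS.
  move=> h; have [_ _ <- _] := g1_sides u; have [_ _ <- _] := g1_sides v.
  have := t_scale u01; have := t_scale v01 => ? ?.
  apply: covered_g1; apply: IH1 => //; try lra.
  exact: gap_low.
Qed.

(** * The seam between the two parts *)

(** In the coordinates of the small part, the seam runs up the left side, along
    the notch and up again; the three sides get the unit intervals of [0, 3]. *)
Definition seam_path r : plane :=
  if r <= 1 then side 3 r else if r <= 2 then side 4 (r - 1) else side 5 (r - 2).

Definition seam n : {fset R} :=
  (marks (n - 3) `|` ((fun x => (1 + x)%R) @` marks (n - 4)
                `|` (fun x => (2 + x)%R) @` marks (n - 5)))%fset.

Lemma seam_path_side i u : (i < 3)%N -> 0 <= u <= 1 ->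
  seam_path (i%:R + u) = side (3 + i) u.
Proof.
move=> i3 u01; rewrite /seam_path; case: i i3 => [|[|[|i]]] // _.
- by rewrite add0r; case/andP: u01 => _ ->.
- have -> : (1 + u <= 2) by lra.
  rewrite [1 + u - 1]addrAC subrr add0r; case: (leP (1 + u) 1) => // u1.
  have -> : u = 0 by lra.
  by rewrite /side addr0 !mulr0 mulr1.
- have -> : (2 + u <= 1) = false by lra.
  rewrite [2 + u - 2]addrAC subrr add0r; case: (leP (2 + u) 2) => // u1.
  have -> : u = 0 by lra.
  by rewrite /side /= addr0 !mulr0 addr0; congr pair; ring.
Qed.

Lemma unit_split r : 0 <= r <= 3 -> exists i u,
  [/\ (i < 3)%N, 0 <= u <= 1 & r = i%:R + u].
Proof.
move=> r03; have [r1|r1] := leP r 1; first by exists 0, r; split => //; lra.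
have [r2|r2] := leP r 2; first by exists 1, (r - 1); split => //; lra.
by exists 2, (r - 2); split => //; lra.
Qed.

Lemma seam_mem n i u : (i < 3)%N -> 0 <= u <= 1 ->
  (i%:R + u \in seam n) = (u \in marks (n - (3 + i))).
Proof.
move=> i3 u01; rewrite /seam !in_fsetU.
apply/orP/idP => [[h|/orP[] /imfsetP[x /= xB e]]|h].
- have := marks_itv h; case: i i3 h => [|[|[|i]]] // _; rewrite ?add0r // => h u1.
    have -> : u = 0 by lra.
    exact: marks0.
  by lra.
- have x01 := marks_itv xB; case: i i3 e => [|[|[|i]]] // _ e.
  + have -> : u = 1 by lra.
    exact: marks1.
  + by have -> : u = x by lra.
  + have -> : u = 0 by lra.
    exact: marks0.
- have x01 := marks_itv xB; case: i i3 e => [|[|[|i]]] // _ e.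
  + by lra.
  + have -> : u = 1 by lra.
    exact: marks1.
  + by have -> : u = x by lra.
- case: i i3 h => [|[|[|i]]] // _ h; first by left; rewrite add0r.
    by right; apply/orP; left; apply/imfsetP; exists u.
  by right; apply/orP; right; apply/imfsetP; exists u.
Qed.

Lemma seam_itv n r : r \in seam n -> 0 <= r <= 3.
Proof.
rewrite /seam !in_fsetU => /orP[/marks_itv|/orP[] /imfsetP[x /= /marks_itv ? ->]];
  by lra.
Qed.

(** The seam turns at the integer parameters, so an axis-parallel segment between
    two of its points cannot go round a corner. *)
Lemma seam_path_axis r r' : 0 <= r <= 3 -> 0 <= r' <= 3 -> r < r' ->
  (seam_path r).1 = (seam_path r').1 \/ (seam_path r).2 = (seam_path r').2 ->
  exists i u v, [/\ (i < 3)%N, 0 <= u <= 1, 0 <= v <= 1,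
                    r = i%:R + u & r' = i%:R + v].
Proof.
move=> r3 r'3 lt.
have t0 := t_gt0; have t1 : 0 < 1 - t by rewrite subr_gt0 t_lt1.
have [i [u [i3 u01 rE]]] := unit_split r3.
have [k [v [k3 v01 r'patchE]]] := unit_split r'3.
have [ik|ik] := eqVneq i k.
  by exists i, u, v; split => //; rewrite ik.
have lik : (i < k)%N.
  rewrite ltn_neqAle ik /= leqNgt; apply/negP => ki.
  have : k.+1%:R <= i%:R :> R by rewrite ler_nat.
  by rewrite -natr1; lra.
rewrite {1 2}rE {1 2}r'patchE !seam_path_side //.
have cancel0 c x : 0 < c -> c * x = 0 -> x = 0.
  by move=> c0 /eqP; rewrite mulf_eq0 gt_eqF //= => /eqP.
have cancel1 c x : 0 < c -> c * x = c -> x = 1.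
  by move=> c0 e; apply: (mulfI (lt0r_neq0 c0)); rewrite mulr1.
have tu := t_scale u01.
have tu' : (1 - t) * u <= 1 - t by nra.
have tv' : 0 <= (1 - t) * v by nra.
case: i i3 rE ik lik => [|[|[|i]]] // _ rE _ lik;
  case: k k3 r'patchE lik => [|[|[|k]]] // _ r'patchE _ /= [e|e].
- have v0 : v = 0 by apply: (cancel0 _ _ t1).
  by exists 0, u, 1; split => //; lra.
- have u1 : u = 1 by apply: (cancel1 _ _ t0).
  by exists 1, 0, v; split => //; lra.
- by lra.
- have u1 : u = 1 by apply: (cancel1 _ _ t0); lra.
  have v0 : v = 0 by apply: (cancel0 _ _ t1); lra.
  by exists 1, 0, 1; split => //; lra.
- have u1 : u = 1 by apply: (cancel1 _ _ t1).
  by exists 2, 0, v; split => //; lra.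
- have v0 : v = 0 by apply: (cancel0 _ _ t1); lra.
  by exists 1, u, 1; split => //; lra.
Qed.

Lemma side_inj i u v : side i u = side i v -> u = v.
Proof.
have t0 : t != 0 by exact: lt0r_neq0 t_gt0.
have t1 : 1 - t != 0 by rewrite lt0r_neq0 // subr_gt0 t_lt1.
case: i => [|[|[|[|[|i]]]]] [] //.
- by move=> /addrI/oppr_inj/(mulfI t0).
- by move=> /(mulfI t0).
- by move=> /(mulfI t1).
- by move=> /addrI/(mulfI t1).
Qed.

Lemma seam_path_inj r r' : 0 <= r <= 3 -> 0 <= r' <= 3 ->
  seam_path r = seam_path r' -> r = r'.
Proof.
have lt_neq x y : 0 <= x <= 3 -> 0 <= y <= 3 -> x < y -> seam_path x <> seam_path y.
  move=> x3 y3 xy e.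
  have [|i [u [v [i3 u01 v01 xE yE]]]] := seam_path_axis x3 y3 xy.
    by left; rewrite e.
  move: e xy; rewrite xE yE !seam_path_side // => /side_inj->.
  by rewrite ltxx.
move=> r3 r'3 e; case: (ltgtP r r') => // lt; first by case: (lt_neq r r').
by case: (lt_neq r' r).
Qed.

(** From g1 (x, v) = g2 (x', v') follow v = t + x' and x = t v'.  The condition
    that (x, v) avoids the notch then pushes (x', v') to the left side or above
    height t, and there it is on the boundary of its own notch. *)
Lemma interface p q : region p -> region q -> g1 p = g2 q ->
  exists i u, [/\ (i < 3)%N, 0 <= u <= 1 & q = side (3 + i) u].
Proof.
case: p => x v; case: q => x' v' [/= x01 v01 px] [/= x'01 v'01 qx] [e1 e2].
have t0 := t_gt0; have t1 : 0 < 1 - t by rewrite subr_gt0 t_lt1.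
have vE : v = t + x'.
  by apply: (mulfI (lt0r_neq0 t0)); rewrite mulrDr tt; lra.
have scale (c y : R) : 0 < c -> 0 <= y <= c -> 0 <= y / c <= 1.
  by move=> c0 yc; rewrite ler_pdivrMr // mul1r divr_ge0; lra.
have scaleK (c y : R) : 0 < c -> c * (y / c) = y.
  by move=> c0; rewrite mulrC divfK // lt0r_neq0.
case/orP: px => px.
  have v't : v' <= t by case/orP: qx; lra.
  exists 0, (v' / t); rewrite scale //=; last by lra.
  by split => //; rewrite scaleK //; congr pair; lra.
have tv' : t <= v' by rewrite -(ler_pM2l t0) tt; lra.
case/orP: qx => qx.
  exists 1, (x' / (1 - t)); rewrite scale //=; last by lra.
  by split => //; rewrite scaleK //; congr pair; lra.
exists 2, ((v' - t) / (1 - t)); rewrite scale //=; last by lra.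
by split => //; rewrite scaleK //; congr pair; lra.
Qed.

(** * The large part along the seam *)

(** The sides of the large part that [g1] maps onto the seam, with the parameter
    coming from the small part. *)
Definition facing i u : plane :=
  match i with
  | 0 => side 4 u
  | 1 => side 5 u
  | _ => side 2 (1 - (1 - t) * u)
  end.

(** The point [side 2 t] is the place on the top of the large part where the
    notch corner [side 5 1] of the small part arrives. *)
Definition patchV_top n : {fset plane} := (side 2 t |` patchV n.+1)%fset.

Lemma facingE i u : (i < 3)%N -> g2 (side (3 + i) u) = g1 (facing i u).
Proof.
by move=> i3; have [h0 h1 h2] := interface_sides u; case: i i3 => [|[|[|i]]].
Qed.

Lemma facing_affine i u v x :
  facing i ((1 - x) * u + x * v) = lerp (facing i u) (facing i v) x.
Proof.
case: i => [|[|i]]; rewrite /facing -side_affine //.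
by congr (side 2 _); ring.
Qed.

(** For i = 2 and n < 3 this holds only thanks to the extra point of
    [patchV_top], whose parameter is u = 1. *)
Lemma facing_vertex n i u : (i < 3)%N -> 0 <= u <= 1 ->
  (facing i u \in patchV_top n) = (u \in marks (n - (3 + i))).
Proof.
move=> i3 u01; have t0 := t_gt0; have t2 := t_gt_half; have t1 := t_lt1.
rewrite /patchV_top in_fsetU in_fset1.
have tu : 0 <= (1 - t) * u <= 1 by nra.
case: i i3 => [|[|[|i]]] // _; rewrite /facing side_vertex //; try lra.
- rewrite subSS orb_idl // xpair_eqE => /andP[_ /eqP e]; lra.
- rewrite subSS orb_idl // xpair_eqE => /andP[/eqP e _].
  by move: e; rewrite tt; lra.
- rewrite subSS (_ : n - (3 + 2) = n - 1 - 4)%N; last by rewrite -subnDA.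
  rewrite -marks_high_trunc // orbC.
  congr orb; rewrite xpair_eqE eqxx andbT; apply/eqP/eqP => [e|->].
    apply: (mulfI (lt0r_neq0 (_ : 0 < t * (1 - t)))); last by lra.
    by rewrite mulr_gt0 ?subr_gt0.
  by ring.
Qed.

Lemma facing_cover n i u v : (i < 3)%N -> 0 <= u <= 1 -> 0 <= v <= 1 ->
  gap (marks (n - (3 + i))) u v -> covered (patchS n.+1) (facing i u) (facing i v).
Proof.
move=> i3 u01 v01 h; have t0 := t_gt0; have t1 := t_lt1.
have tu : 0 <= (1 - t) * u <= 1 by nra.
have tv : 0 <= (1 - t) * v <= 1 by nra.
case: i i3 h => [|[|[|i]]] // _ h; apply: side_cover => //; try lra.
rewrite subSS; apply: gap_high => //.
by rewrite -subnDA.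
Qed.

(** A parametrised segment is an edge as soon as its ends are vertices, nothing
    between them is, and it is covered by one side of a tile. *)
Lemma edge_of_param (q : R -> plane) L X B u v :
  (forall u v x, q ((1 - x) * u + x * v) = lerp (q u) (q v) x) ->
  (forall u, 0 <= u <= 1 -> (q u \in X) = (u \in B)) ->
  covered L (q u) (q v) -> 0 <= u <= 1 -> 0 <= v <= 1 ->
  u \in B -> v \in B -> q u != q v -> gap B u v -> edge_rel L X (q u) (q v).
Proof.
move=> qA qX cov u01 v01 uB vB quv h; split=> //; rewrite ?qX //.
move=> _ /[swap] -[x x01 ->]; rewrite -/(lerp _ _ _) -qA.
set w := _ + _; have w01 : 0 <= w <= 1 by rewrite /w; nra.
rewrite qX // => /h hw.
have [x0|x0] := eqVneq x 0; first by left; rewrite /w x0; congr q; ring.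
have [x1|x1] := eqVneq x 1; first by right; rewrite /w x1; congr q; ring.
left; congr q; apply/eqP; rewrite eq_sym -subr_eq0.
(* w is a mean of u and v, so the weighted distances below cancel; having the
   same sign, they vanish. *)
have w_between : (1 - x) * (u - w) + x * (v - w) = 0 by rewrite /w; ring.
have : (1 - x) * (u - w) == 0.
  by case: hw => -[wu wv]; nra.
by rewrite mulf_eq0 => /orP[/eqP x1'|//]; case/eqP: x1; lra.
Qed.

(** * Gluing the two parts *)

Lemma side_segment i u : 0 <= u <= 1 -> segment (side i 0) (side i 1) (side i u).
Proof.
move=> u01; exists u => //; rewrite -[RHS]/(lerp _ _ _) -side_affine.
by congr side; ring.
Qed.

Lemma hexagon_side s : s \in polygon_sides hexagon1 -> exists2 i, (i < 6)%N &
  s = (side i 0, side i 1) \/ s = (side i 1, side i 0).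
Proof.
have e2 : t + (1 - t) = 1 by ring.
have sideE : [/\ (0, 0) = side 0 0, (1, 0) = side 0 1, (1, 0) = side 1 0,
  (1, 1) = side 1 1 & (1, 1) = side 2 0] /\
  [/\ (1 - t, 1) = side 2 1, (1 - t, 1) = side 5 1, (1 - t, t) = side 5 0,
  (1 - t, t) = side 4 1 & (0, t) = side 4 0] /\
  ((0, t) = side 3 1 /\ (0, 0) = side 3 0).
  by rewrite /side !mulr0 !mulr1 !subr0 !addr0 e2.
case: sideE => -[e00 e01 e10 e11 e20] [[e21 e51 e50 e41 e40] [e31 e30]].
rewrite !inE => /orP[/eqP->|]; first by exists 0; [|left; rewrite {1}e00 e01].
case/orP => [/eqP->|]; first by exists 1; [|left; rewrite {1}e10 e11].
case/orP => [/eqP->|]; first by exists 2; [|left; rewrite {1}e20 e21].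
case/orP => [/eqP->|]; first by exists 5; [|right; rewrite {1}e51 e50].
case/orP => [/eqP->|]; first by exists 4; [|right; rewrite {1}e41 e40].
by rewrite ?orbF => /eqP->; exists 3; [|right; rewrite {1}e31 e30].
Qed.

Lemma patchS_induction (P : plane * plane -> Prop) :
  (forall s, s \in polygon_sides hexagon1 -> P s) ->
  (forall s, P s -> P (map_side g1 s)) -> (forall s, P s -> P (map_side g2 s)) ->
  forall n s, s \in patchS n -> P s.
Proof.
move=> Ph P1 P2; elim/ltn_ind => -[|[|n]] IH s; try by rewrite /patchS /= => /Ph.
rewrite patchS_step mem_cat => /orP[] /mapP[s' s'S ->].
  exact/P1/(IH n.+1).
exact/P2/(IH n).
Qed.

Lemma patchS_region n s : s \in patchS n -> segment s.1 s.2 `<=` region.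
Proof.
move: n s; apply: patchS_induction => [s /hexagon_side[i i6 h]|s h|s h].
- have -> : segment s.1 s.2 = segment (side i 0) (side i 1).
    by case: h => -> //=; rewrite segmentC.
  by move=> _ [u u01 ->]; rewrite -/(lerp _ _ _) -side_affine; apply: region_side; lra.
- by rewrite (segment_affine _ _ g1_affine) => _ [z /h zr <-]; exact: region_g1.
- by rewrite (segment_affine _ _ g2_affine) => _ [z /h zr <-]; exact: region_g2.
Qed.

Lemma patchS_axis n s : s \in patchS n -> s.1.1 = s.2.1 \/ s.1.2 = s.2.2.
Proof.
move: n s; apply: patchS_induction => [s /hexagon_side[i i6 h]|s h|s h].
- by case: i i6 h => [|[|[|[|[|[|i]]]]]] // _ [] ->; rewrite /side /=; tauto.
- by case: h => /= ->; tauto.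
- by case: h => /= ->; tauto.
Qed.

Lemma patchS_ends n s : s \in patchS n -> s.1 \in patchV n /\ s.2 \in patchV n.
Proof.
elim/ltn_ind: n s => -[|[|n]] IH s; last first.
  rewrite patchS_step patchV_step mem_cat !in_fsetU => /orP[] /mapP[s' s'S ->] /=.
    by have [h1 h2] := IH n.+1 (leqnn _) _ s'S; rewrite !mem_g1 h1 h2.
  by have [h1 h2] := IH n (leqnSn _) _ s'S; rewrite !mem_g2 h1 h2 !orbT.
all: rewrite /patchS /= => /hexagon_side[i i6 h].
all: by case: h => -> /=; rewrite !side_hexagon ?eqxx ?orbT // ?lexx ?ler01.
Qed.

Lemma facing_split z : region z ->
  forall p, region p -> g1 p = g2 z ->
  exists i u, [/\ (i < 3)%N, 0 <= u <= 1, z = side (3 + i) u & p = facing i u].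
Proof.
move=> rz p rp e; have [i [u [i3 u01 zE]]] := interface rp rz e.
exists i, u; split=> //; apply: g1_inj; by rewrite e zE facingE.
Qed.

Lemma patchV_top_region n p : p \in patchV_top n -> region p.
Proof.
rewrite in_fsetU in_fset1 => /orP[/eqP->|]; last exact: patchV_region.
by apply: region_side; have := t_gt0; have := t_lt1; lra.
Qed.

Lemma interface_vertex n p q : region p -> region q -> g1 p = g2 q ->
  (p \in patchV_top n) = (q \in patchV n).
Proof.
move=> rp rq e; have [i [u [i3 u01 -> ->]]] := facing_split rq rp e.
by rewrite facing_vertex // side_vertex //.
Qed.

(** The extra point of the large part is a corner of the small part. *)
Lemma patchV_step_top n : patchV n.+2 = (g1 @` patchV_top n `|` g2 @` patchV n)%fset.
Proof.
apply/fsetP => z; rewrite patchV_step !in_fsetU; apply/orP/orP; last first.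
  case=> [/imfsetP[p /= pW ->]|]; last by right.
  move: pW; rewrite in_fsetU in_fset1 => /orP[/eqP->|pV]; last by left; rewrite mem_g1.
  right; have -> : side 2 t = facing 2 1 by rewrite /facing; congr (side 2 _); ring.
  by rewrite -facingE // mem_g2 side_vertex ?marks1 // ?ler01 ?lexx.
case=> [/imfsetP[p /= pW ->]|]; last by right.
by left; rewrite mem_g1 in_fsetU pW orbT.
Qed.

(** On the seam both parts have the same vertices, which is the hypothesis of
    [edge_set_glue]. *)
Lemma patchE_step n : patchE n.+2 =
  (edge_set (map (map_side g1) (patchS n.+1)) (g1 @` patchV_top n) `|`
   edge_set (map (map_side g2) (patchS n)) (g2 @` patchV n))%fset.
Proof.
rewrite /patchE patchV_step_top patchS_step.
apply: (@edge_set_glue _ _ _ _ _ (g1 @` region) (g2 @` region)).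
- move=> _ /mapP[s sS ->] /=; rewrite (segment_affine _ _ g1_affine).
  exact/image_subset/(patchS_region sS).
- move=> _ /mapP[s sS ->] /=; rewrite (segment_affine _ _ g2_affine).
  exact/image_subset/(patchS_region sS).
- move=> _ /imfsetP[q /= qV ->] [p rp e].
  by rewrite -e mem_g1 (interface_vertex _ rp (patchV_region qV) e).
- move=> _ /imfsetP[p /= pW ->] [q rq e].
  by rewrite -e mem_g2 -(interface_vertex _ (patchV_top_region pW) rq).
Qed.

Lemma seam_path_vertex n r : 0 <= r <= 3 -> (seam_path r \in patchV n) = (r \in seam n).
Proof.
move=> /unit_split[i [u [i3 u01 ->]]].
by rewrite seam_path_side // seam_mem // side_vertex //.
Qed.

Lemma interface_cap n :
  (g1 @` patchV_top n `&` g2 @` patchV n)%fset =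
  ((fun r => g2 (seam_path r)) @` seam n)%fset.
Proof.
apply/fsetP => z; rewrite in_fsetI; apply/andP/imfsetP.
  move=> [/imfsetP[p /= pW zE] /imfsetP[q /= qV zE']].
  have [i [u [i3 u01 qE pE]]] := facing_split (patchV_region qV)
    (patchV_top_region pW) (etrans (esym zE) zE').
  have r3 : 0 <= i%:R + u <= 3 by case: i i3 {qE pE} => [|[|[|i]]] // _; lra.
  exists (i%:R + u) => /=; last by rewrite seam_path_side // zE' qE.
  by rewrite -seam_path_vertex // seam_path_side // -qE.
move=> [r /= rG ->]; have r3 := seam_itv rG.
rewrite mem_g2 seam_path_vertex //; split => //.
have [i [u [i3 u01 rE]]] := unit_split r3.
by move: rG; rewrite rE seam_path_side // seam_mem // facingE // mem_g1 facing_vertex.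
Qed.

Lemma card_patchV_step n :
  (#|` patchV n.+2| + #|` seam n| = #|` patchV_top n| + #|` patchV n|)%N.
Proof.
have inj1 X : #|` (g1 @` X)%fset| = #|` X : {fset plane}|.
  by rewrite card_imfset //; exact: g1_inj.
have inj2 X : #|` (g2 @` X)%fset| = #|` X : {fset plane}|.
  by rewrite card_imfset //; exact: g2_inj.
have injG : #|` ((fun r => g2 (seam_path r)) @` seam n)%fset| = #|` seam n|.
  rewrite card_in_imfset // => r r' /= /seam_itv r3 /seam_itv r'3.
  by move=> /g2_inj; exact: seam_path_inj.
rewrite -(inj1 (patchV_top n)) -(inj2 (patchV n)) -cardfsUI -patchV_step_top.
by rewrite interface_cap injG.
Qed.

(** Sides of tiles are axis-parallel, so the edge stays on one straight piece of
    the seam by [seam_path_axis], and a vertex with an intermediate parameter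
    would lie on it. *)
Lemma seam_path_edge_consecutive n a b : a \in seam n -> b \in seam n -> a < b ->
  edge_rel (patchS n) (patchV n) (seam_path a) (seam_path b) ->
  forall c, c \in seam n -> a < c -> b <= c.
Proof.
move=> aG bG ab [_ _ _ [s' s'S ss'] h] c cG ac; rewrite leNgt; apply/negP => cb.
(* Two points of an axis-parallel side share a coordinate. *)
have axis : (seam_path a).1 = (seam_path b).1 \/ (seam_path a).2 = (seam_path b).2.
  have [u u01 ->] := ss' _ (segment_l _ _); have [v v01 ->] := ss' _ (segment_r _ _).
  by case: (patchS_axis s'S) => /= ->; [left|right]; ring.
have [i [u [v [i3 u01 v01 aE bE]]]] := seam_path_axis (seam_itv aG) (seam_itv bG) ab axis.
have c01 : 0 <= c - i%:R <= 1 by lra.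
have cE : c = i%:R + (c - i%:R) by rewrite addrC subrK.
have pc : segment (seam_path a) (seam_path b) (seam_path c).
  rewrite aE bE cE !seam_path_side //; set w := c - _.
  exists ((w - u) / (v - u)).
    by rewrite ler_pdivrMr ?divr_ge0 ?mul1r; rewrite /w; lra.
  rewrite -[RHS]/(lerp _ _ _) -side_affine; congr side.
  have vu : v - u != 0 by rewrite lt0r_neq0 //; lra.
  by field.
have := h (seam_path c); rewrite seam_path_vertex ?(seam_itv cG) //.
move=> /(_ cG pc)[] /seam_path_inj.
  by move=> /(_ (seam_itv cG) (seam_itv aG)) ca; rewrite ca ltxx in ac.
by move=> /(_ (seam_itv cG) (seam_itv bG)) ca; rewrite ca ltxx in cb.
Qed.

(** The common edges are the segments between consecutive points of the seam:
    a common edge has its ends on the seam, and conversely [side_cover] and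
    [facing_cover] provide the covering sides in both parts. *)
Lemma card_patchE_cap n :
  #|` (edge_set (map (map_side g1) (patchS n.+1)) (g1 @` patchV_top n) `&`
      edge_set (map (map_side g2) (patchS n)) (g2 @` patchV n))%fset|.+1 = #|` seam n|.
Proof.
apply: (@card_consecutive _ _ (fun r => g2 (seam_path r))).
- by move=> r r' /seam_itv r3 /seam_itv r'3 /g2_inj; exact: seam_path_inj.
- apply/fset0Pn; exists 0.
  by rewrite -[X in X \in _](addr0 0%:R) seam_mem ?marks0 ?lexx ?ler01.
move=> e; rewrite in_fsetI; split=> [/andP[]|[a [b [aG bG ab h ->]]]].
  move=> /edge_setP[x [y [exy1 ->]]] /edge_set2 exy2.
  have [xW yW _ _ _] := exy1; have [xV yV xy [s sS ss] hz] := exy2.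
  have /imfsetP[a /= aG xE] : x \in ((fun r => g2 (seam_path r)) @` seam n)%fset.
    by rewrite -interface_cap in_fsetI xW.
  have /imfsetP[b /= bG yE] : y \in ((fun r => g2 (seam_path r)) @` seam n)%fset.
    by rewrite -interface_cap in_fsetI yW.
  have {}exy2 : edge_rel (patchS n) (patchV n) (seam_path a) (seam_path b).
    by apply/(edge_rel_affine _ _ _ _ g2_affine g2_inj); rewrite -xE -yE.
  have [ab|ba|ab] := ltgtP a b; last by rewrite xE yE ab eqxx in xy.
    by exists a, b; rewrite -xE -yE; split => //; exact: seam_path_edge_consecutive exy2.
  exists b, a; rewrite -xE -yE fsetUC; split => //; apply: seam_path_edge_consecutive => //.
  exact: edge_relC.
have a3 := seam_itv aG; have b3 := seam_itv bG.
have [i [u [v [i3 u01 v01 aE bE]]]] : exists i u v,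
    [/\ (i < 3)%N, 0 <= u <= 1, 0 <= v <= 1, a = i%:R + u & b = i%:R + v].
  (* The turning points 1 and 2 belong to the seam vertices. *)
  have node k : (k < 3)%N -> a < k%:R -> b <= k%:R.
    move=> k3; apply: h; rewrite -[X in X \in _]addr0 seam_mem ?marks0 ?lexx ?ler01 //.
  have b1 := node 1 isT; have b2 := node 2 isT.
  have [/b1 ?|a1] := ltP a 1; first by exists 0, a, b; split => //; lra.
  have [/b2 ?|a2] := ltP a 2.
    by exists 1, (a - 1), (b - 1); split => //; lra.
  by exists 2, (a - 2), (b - 2); split => //; lra.
have uv : u < v by move: ab; rewrite aE bE; lra.
have cl : gap (marks (n - (3 + i))) u v.
  move=> r rB; have r01 := marks_itv rB; have [ru|ur] := leP r u.
    by left; split => //; lra.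
  right; split; first exact: ltW.
  have := h (i%:R + r); rewrite seam_mem // => /(_ rB).
  by rewrite aE bE lerD2l ltrD2l; apply.
have uB : u \in marks (n - (3 + i)) by rewrite -seam_mem // -aE.
have vB : v \in marks (n - (3 + i)) by rewrite -seam_mem // -bE.
rewrite aE bE !seam_path_side //; apply/andP; split; apply/edge_set2.
  rewrite !facingE //; apply/(edge_rel_affine _ _ _ _ g1_affine g1_inj).
  apply: (edge_of_param (B := marks (n - (3 + i))) (q := facing i)) => //.
  - by move=> *; exact: facing_affine.
  - by move=> w w01; exact: facing_vertex.
  - exact: facing_cover.
  - apply/eqP => /(congr1 g1); rewrite -!facingE // => /g2_inj/side_inj uvE.
    by rewrite uvE ltxx in uv.
apply/(edge_rel_affine _ _ _ _ g2_affine g2_inj).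
have i6 : (3 + i < 6)%N by rewrite (ltn_add2l 3 i 3).
apply: (edge_of_param (B := marks (n - (3 + i))) (q := side (3 + i))) => //.
- by move=> *; exact: side_affine.
- by move=> w w01; exact: side_vertex.
- exact: side_cover.
- by apply/eqP => /side_inj uvE; rewrite uvE ltxx in uv.
Qed.

Lemma card_patchE_step n : (#|` patchE n.+2| + #|` seam n| =
  #|` edge_set (patchS n.+1) (patchV_top n)| + #|` patchE n| + 1)%N.
Proof.
rewrite -(card_edge_set_affine _ _ g1_affine g1_inj).
rewrite -(card_edge_set_affine _ (patchV n) g2_affine g2_inj).
by rewrite -cardfsUI -patchE_step -card_patchE_cap addnS addn1.
Qed.

(** * Counting *)

Lemma t_in_marks m : (t \in marks m) = (1 < m)%N.
Proof.
case: m => [|[|m]]; last first.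
  by rewrite -[X in X \in _]subr0 -[X in _ - X](mulr0 t) marks_low ?marks0 ?lexx ?ler01.
all: rewrite marks_small //; apply/negbTE; rewrite negb_or.
all: by rewrite gt_eqF ?t_gt0 // lt_eqF // t_lt1.
Qed.

(** The top has the marks of two generations before, and t is a mark as
    soon as the hexagon has been cut once. *)
Lemma extra_in_patchV n : (side 2 t \in patchV n.+1) = (2 < n)%N.
Proof.
have t1 := t_lt1; have t0 := t_gt0.
by rewrite side_vertex ?t_in_marks ?subSS ?ltn_subRL //; lra.
Qed.

Lemma card_patchV_top n : #|` patchV_top n| = ((n < 3) + #|` patchV n.+1|)%N.
Proof. by rewrite cardfsU1 extra_in_patchV -leqNgt. Qed.

(** For n < 3 the top of the large part is a single edge, and as the hexagon does
    not rise above its top, a side of a tile through an inner point of the top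
    lies on it. *)
Lemma card_patchE_top n :
  #|` edge_set (patchS n.+1) (patchV_top n)| = ((n < 3) + #|` patchE n.+1|)%N.
Proof.
have t1 := t_lt1; have t0 := t_gt0.
have [n3|n3] := ltnP n 3; last first.
  by rewrite /patchV_top (fsetUidPr _ _ _) // fsub1set extra_in_patchV.
have wV : side 2 t \notin patchV n.+1 by rewrite extra_in_patchV -leqNgt.
have smallB u : (u \in marks (n.+1 - 2)) = (u == 0) || (u == 1).
  by rewrite marks_small //; case: n n3 {wV} => [|[|[|n]]].
have topV u : 0 <= u <= 1 -> side 2 u \in patchV n.+1 -> u = 0 \/ u = 1.
  by move=> u01; rewrite side_vertex // smallB => /orP[] /eqP; [left|right].
have I0 : 0 <= (0 : R) <= 1 by rewrite lexx ler01.
have I1 : 0 <= (1 : R) <= 1 by rewrite lexx ler01.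
have cl : gap (marks (n.+1 - 2)) 0 1.
  by move=> r; rewrite smallB => /orP[] /eqP->; [left|right]; rewrite lexx ler01.
apply: (@card_edge_set_subdivide _ _ _ (side 2 0) (side 2 1)) => //.
- apply: (edge_of_param (q := side 2) (B := marks (n.+1 - 2))) => //.
  + by move=> *; exact: side_affine.
  + by move=> u u01; exact: side_vertex.
  + exact: side_cover.
  + exact: marks0.
  + exact: marks1.
  + by apply/eqP => /side_inj/eqP; rewrite eq_sym oner_eq0.
- by apply: side_segment; lra.
move=> s sS ws y yV ys.
have [s1V s2V] := patchS_ends sS.
have [s1x s1y _] := patchV_region s1V; have [s2x s2y _] := patchV_region s2V.
(* A mean of two ordinates at most 1 with positive weights equals 1 only if both
   are 1; zero weights would make the extra point an end of the side. *)
have top : s.1.2 = 1 /\ s.2.2 = 1.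
  have [x x01 wE] := ws; have e2 := congr1 snd wE; rewrite /= in e2.
  have [x0|x0] := eqVneq x 0.
    case/negP: wV; rewrite wE x0.
    by rewrite !mul0r !addr0 subr0 !mul1r -surjective_pairing.
  have [x1|x1] := eqVneq x 1.
    case/negP: wV; rewrite wE x1.
    by rewrite subrr !mul0r !add0r !mul1r -surjective_pairing.
  have x'0 : 0 < x by rewrite lt_def x0; case/andP: x01.
  have x'1 : 0 < 1 - x by rewrite subr_gt0 lt_def eq_sym x1; case/andP: x01.
  have : 0 <= (1 - x) * (1 - s.1.2) by apply: mulr_ge0; lra.
  have : 0 <= x * (1 - s.2.2) by apply: mulr_ge0; lra.
  move=> h1 h2; have z1 : (1 - x) * (1 - s.1.2) = 0 by lra.
  have z2 : x * (1 - s.2.2) = 0 by lra.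
  move/eqP: z1; rewrite mulf_eq0 gt_eqF //= subr_eq0 => /eqP <-.
  by move/eqP: z2; rewrite mulf_eq0 gt_eqF //= subr_eq0 => /eqP <-.
have y2 : y.2 = 1.
  by case: ys => x x01 -> /=; case: top => -> ->; ring.
have [yx _ yt] := patchV_region yV.
have y1 : 1 - t <= y.1 by case/orP: yt; lra.
have u01 : 0 <= (1 - y.1) / t <= 1 by rewrite ler_pdivrMr // mul1r divr_ge0; lra.
have yE : y = side 2 ((1 - y.1) / t).
  by rewrite /side [t * _]mulrC divfK ?lt0r_neq0 // subKr -y2 -surjective_pairing.
by move: yV; rewrite yE => /(topV _ u01)[] ->; [left|right].
Qed.

(** The two copies share only the point t. *)
Lemma card_marks_step m :
  (#|` marks m.+2| + 1 = #|` marks m| + #|` marks (m - 2)|)%N.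
Proof.
have t0 := t_gt0; have t1 := t_lt1.
rewrite marks_step /subdivide.
set A := ((fun x => _) @` marks m)%fset; set B := ((fun x => _) @` _)%fset.
have -> : #|` marks m| = #|` A|.
  by rewrite card_imfset // => x y /addrI/oppr_inj/(mulfI (lt0r_neq0 t0)).
have -> : #|` marks (m - 2)| = #|` B|.
  rewrite card_imfset // => x y /addrI/oppr_inj/mulfI-> //.
  by rewrite lt0r_neq0 // subr_gt0.
rewrite -cardfsUI; congr addn.
rewrite -(cardfs1 t); congr (#|` _ |); apply/fsetP => x.
rewrite in_fsetI in_fset1; apply/eqP/andP => [->|].
  split; apply/imfsetP.
    by exists 0; rewrite ?marks0 // mulr0 subr0.
  by exists 1; rewrite ?marks1 // mulr1 subKr.
move=> [/imfsetP[y /= yB ->] /imfsetP[z /= zB e]].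
have := t_scale (marks_itv yB); have := marks_itv zB => z01.
by have : (1 - t) * z <= 1 - t; [nra|lra].
Qed.

Lemma card_marks m : #|` marks m| = (fib m./2.+2).+1.
Proof.
have b2 : #|` [fset (0 : R); 1]%fset| = 2%N by rewrite cardfs2 eq_sym oner_eq0.
elim/ltn_ind: m => -[|[|[|[|m]]]] IH //.
- by have := card_marks_step 0; rewrite !b2 addn1 => -[].
- by have := card_marks_step 1; rewrite !b2 addn1 => -[].
have := card_marks_step m.+2; rewrite !subSS subn0.
have lt4 : (m < m.+4)%N by rewrite ltnS -(addn3 m) leq_addr.
rewrite (IH m.+2) // (IH m lt4).
have -> : fib m.+4./2.+2 = (fib m.+2./2.+2 + fib m./2.+2)%N by [].
by lia.
Qed.

(** Consecutive pieces of the seam share the integer point where it turns. *)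
Lemma card_seam n : (#|` seam n| + 2 =
  #|` marks (n - 3)| + #|` marks (n - 4)| + #|` marks (n - 5)|)%N.
Proof.
rewrite /seam; set A := marks (n - 3).
set B := ((fun x => _) @` marks (n - 4))%fset.
set C := ((fun x => _) @` marks (n - 5))%fset.
have -> : #|` marks (n - 4)| = #|` B| by rewrite card_imfset //; exact: addrI.
have -> : #|` marks (n - 5)| = #|` C| by rewrite card_imfset //; exact: addrI.
have BC : #|` (B `&` C)%fset| = 1%N.
  rewrite -(cardfs1 (2 : R)); congr (#|` _ |); apply/fsetP => x.
  rewrite in_fsetI in_fset1; apply/andP/eqP => [|->]; last first.
    split; apply/imfsetP; first by exists 1; rewrite ?marks1.
    by exists 0; rewrite ?marks0 // addr0.
  move=> [/imfsetP[y /= /marks_itv yB ->] /imfsetP[z /= /marks_itv zB e]]; lra.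
have ABC : #|` (A `&` (B `|` C))%fset| = 1%N.
  rewrite -(cardfs1 (1 : R)); congr (#|` _ |); apply/fsetP => x.
  rewrite in_fsetI in_fsetU in_fset1; apply/andP/eqP => [|->]; last first.
    split; first exact: marks1.
    by apply/orP; left; apply/imfsetP; exists 0; rewrite ?marks0 // addr0.
  by move=> [/marks_itv xA /orP[] /imfsetP[y /= /marks_itv yB e]]; lra.
have := cardfsUI B C; have := cardfsUI A (B `|` C)%fset.
by rewrite BC ABC => h1 h2; rewrite (addnA _ 1 1) h1 -addnA h2 addnA.
Qed.

Lemma hexagon_uniq : uniq hexagon1.
Proof.
have t0 := t_gt0; have t1 := t_lt1; have t2 := t_gt_half.
rewrite /= !inE !xpair_eqE !negb_or.
have n1 : (1 == 1 - t) = false by apply/eqP; lra.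
have n2 : (0 == 1 - t) = false by apply/eqP; lra.
have n3 : (0 == t) = false by apply/eqP; lra.
have n4 : (1 == t) = false by apply/eqP; lra.
have n5 : (1 - t == 0) = false by apply/eqP; lra.
have n6 : (0 == 1 :> R) = false by apply/eqP; lra.
by rewrite n1 n2 n3 n4 n5 n6 oner_eq0 /= ?andbF ?andbT.
Qed.

Lemma card_patchV_hexagon n : (n < 2)%N -> #|` patchV n| = 6%N.
Proof.
move=> n2; rewrite /patchV; have -> : hexes n = [:: hexagon1] by case: n n2 => [|[]].
by rewrite card_fseq (_ : flatten _ = hexagon1) // undup_id ?hexagon_uniq.
Qed.

(** An edge spans a whole side, as the only corners on a side are its ends.  The
    six pairs of ends are distinct, since two consecutive steps around the hexagon
    do not lead back to the starting corner. *)
Lemma card_patchE_hexagon n : (n < 2)%N -> #|` patchE n| = 6%N.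
Proof.
move=> n2; have I0 : 0 <= (0 : R) <= 1 by rewrite lexx ler01.
have I1 : 0 <= (1 : R) <= 1 by rewrite lexx ler01.
have SE : patchS n = polygon_sides hexagon1 by case: n n2 => [|[]].
pose ends (s : plane * plane) := [fset s.1; s.2]%fset.
pose c i := nth (0, 0) hexagon1 i.
have sidesE s : s \in polygon_sides hexagon1 ->
    exists2 i, (i < 6)%N & s = (c i, c (i.+1 %% 6)%N).
  rewrite !inE.
  case/orP => [/eqP->|]; first by exists 0.
  case/orP => [/eqP->|]; first by exists 1.
  case/orP => [/eqP->|]; first by exists 2.
  case/orP => [/eqP->|]; first by exists 3.
  case/orP => [/eqP->|]; first by exists 4.
  by rewrite ?orbF => /eqP->; exists 5.
have cI i k : (i < 6)%N -> (k < 6)%N -> c i = c k -> i = k.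
  by move=> i6 k6 /eqP; rewrite nth_uniq ?hexagon_uniq // => /eqP.
have -> : patchE n = [fset e in map ends (polygon_sides hexagon1)]%fset.
  apply/fsetP => e; transitivity (e \in map ends (polygon_sides hexagon1));
    last by rewrite in_fset.
  apply/idP/mapP.
    move=> /edge_setP[x [y [[xV yV xy [s sS ss] h] ->]]]; rewrite SE in sS.
    exists s => //; have [i i6 sE] := hexagon_side sS.
    have segE : segment s.1 s.2 = segment (side i 0) (side i 1).
      by case: sE => -> //=; rewrite segmentC.
    have endsE : ends s = [fset side i 0; side i 1]%fset.
      by case: sE => ->; rewrite /ends //= fsetUC.
    have corner z : z \in patchV n -> segment x y z -> z = side i 0 \/ z = side i 1.
      move=> zV /ss; rewrite segE => -[u u01 zE].
      have {}zE : z = side i u.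
        by rewrite zE -/(lerp _ _ _) -side_affine; congr side; ring.
      by move: zV; rewrite zE side_hexagon // => /orP[] /eqP->; [left|right].
    rewrite endsE; move: xy.
    case: (corner x xV (segment_l _ _)) => ->;
      case: (corner y yV (segment_r _ _)) => ->; rewrite ?eqxx //.
    by rewrite fsetUC.
  move=> [s sS ->]; have [i i6 sE] := hexagon_side sS.
  have -> : ends s = [fset side i 0; side i 1]%fset.
    by case: sE => ->; rewrite /ends //= fsetUC.
  apply/edge_set2; apply: (edge_of_param (q := side i) (B := marks 0)) => //.
  - by move=> *; exact: side_affine.
  - by move=> u u01; rewrite side_hexagon // marks_small.
  - exact: side_cover_hexagon.
  - exact: marks0.
  - exact: marks1.
  - by apply/eqP => /side_inj/eqP; rewrite eq_sym oner_eq0.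
  - by move=> r; rewrite marks_small // => /orP[] /eqP->; [left|right]; rewrite lexx ler01.
rewrite card_fseq undup_id ?size_map // map_inj_in_uniq.
  by apply: (@map_uniq _ _ fst); exact: hexagon_uniq.
move=> s s' /sidesE[i i6 ->] /sidesE[k k6 ->] /fset2_inj[] [] /=.
  by move=> /(cI _ _ i6 k6)->.
move=> /cI e1 /cI e2; exfalso.
have {}e1 := e1 i6 (ltn_pmod k.+1 (isT : (0 < 6)%N)).
have {}e2 := e2 (ltn_pmod i.+1 (isT : (0 < 6)%N)) k6.
move/eqP: e1; rewrite -{}e2 {k6}.
by case: i i6 => [|[|[|[|[|[|i]]]]]].
Qed.

(** This is the formula of Euler for the tiling, F(n+1) being its number of
    tiles; here it follows from the recurrences since the seam carries one edge
    less than vertices. *)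
Lemma euler n : (#|` patchE n| + 1 = #|` patchV n| + fib n.+1)%N.
Proof.
elim/ltn_ind: n => -[|[|n]] IH; try by rewrite card_patchE_hexagon // card_patchV_hexagon.
have := card_patchV_step n; have := card_patchE_step n.
rewrite card_patchV_top card_patchE_top.
have := IH n.+1 (leqnn _); have := IH n (leqnSn _).
have -> : fib n.+3 = (fib n.+2 + fib n.+1)%N by [].
lia.
Qed.

Lemma card_patchV_rec n :
  (#|` patchV n.+2| + 1 + fib (n - 3)./2.+2 + fib (n - 4)./2.+2 + fib (n - 5)./2.+2
    = (n < 3) + #|` patchV n.+1| + #|` patchV n|)%N.
Proof.
have := card_patchV_step n; have := card_seam n; rewrite card_patchV_top !card_marks.
lia.
Qed.

End Ammann.

(** * The golden ratio *)

Section Tiling.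
Variable R : realType.
Local Notation plane := (R * R)%type.
Local Notation P := (Psi R).
Local Notation t := (P ^+ 2).

Lemma sqrt5_sq : Num.sqrt 5 * Num.sqrt 5 = 5 :> R.
Proof. by rewrite -expr2 sqr_sqrtr. Qed.

Lemma phi_gt1 : 1 < phi R.
Proof.
have s1 : 1 < Num.sqrt 5 :> R by rewrite -[ltLHS]sqrtr1 ltr_sqrt; lra.
by rewrite /phi; lra.
Qed.

Lemma phi_gt0 : 0 < phi R. Proof. exact: lt_trans ltr01 phi_gt1. Qed.

Lemma phi_sq : phi R * phi R = phi R + 1.
Proof. by rewrite /phi; have := sqrt5_sq; lra. Qed.

Lemma Psi_gt0 : 0 < P.
Proof. by rewrite invr_gt0 sqrtr_gt0 phi_gt0. Qed.

Lemma Psi_sq : t = (phi R)^-1.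
Proof. by rewrite exprVn sqr_sqrtr // ltW // phi_gt0. Qed.

Lemma tau_gt0 : 0 < t. Proof. by rewrite exprn_gt0 ?Psi_gt0. Qed.

Lemma tau_sq : t * t = 1 - t.
Proof.
have p0 : phi R != 0 by rewrite gt_eqF ?phi_gt0.
apply: (mulfI p0); apply: (mulfI p0); rewrite Psi_sq mulrBr mulr1.
have -> : phi R * (phi R * ((phi R)^-1 * (phi R)^-1)) = 1 by field.
by rewrite divff // mulrBr mulr1 phi_sq; ring.
Qed.

(** * The tiling in rescaled coordinates *)

(** Back from the rescaled coordinates to the original ones. *)
Definition stretch (p : plane) : plane := (p.1, P * p.2).

Lemma stretch_affine : affine stretch.
Proof. by move=> [x y] [x' y'] u; rewrite /stretch /lerp /=; congr pair; ring. Qed.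

Lemma stretch_inj : injective stretch.
Proof.
by move=> [x y] [x' y'] [/= -> /(mulfI (lt0r_neq0 Psi_gt0))->].
Qed.

Lemma stretch_f1 p : f1 (stretch p) = stretch (g1 t p).
Proof. by rewrite /f1 /stretch /g1 /=; congr pair; ring. Qed.

Lemma stretch_f2 p : f2 (stretch p) = stretch (g2 t p).
Proof. by rewrite /f2 /stretch /g2 /=; congr pair; ring. Qed.

Lemma stretch_hexagon : hexagon R = map stretch (hexagon1 t).
Proof.
have t4 : P ^+ 4 = 1 - t by rewrite -tau_sq -exprD.
by rewrite /hexagon /hexagon1 /stretch /= !mulr0 !mulr1 t4 -exprS.
Qed.

Definition move_tile (g : plane -> plane) (T : tile R) := Tile (large T) (g \o place T).

Lemma iter_subst_cat n (X Y : seq (tile R)) :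
  iter n (@subst R) (X ++ Y) = iter n (@subst R) X ++ iter n (@subst R) Y.
Proof.
elim: n => //= n ->; by rewrite /subst map_cat flatten_cat.
Qed.

Lemma iter_subst_move_tile n g (X : seq (tile R)) :
  iter n (@subst R) (map (move_tile g) X) = map (move_tile g) (iter n (@subst R) X).
Proof.
elim: n => //= n ->; rewrite /subst map_flatten -!map_comp; congr flatten.
by apply: eq_map => -[[] f].
Qed.

(** The first two substitutions of a small tile give the two tiles placed by f1 and
    f2; the remaining ones commute with the placement. *)
Lemma A2_step n :
  A2 R n.+3 = map (move_tile (@f1 R)) (A2 R n.+2) ++ map (move_tile (@f2 R)) (A2 R n.+1).
Proof.
rewrite /A2 -!iter_subst_move_tile [n.+2.-1]/= iterSr.
by rewrite -iter_subst_cat [n.+3.-1]/= !iterSr.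
Qed.

Lemma corners_A2 n : map (@corners R) (A2 R n.+1) = map (map stretch) (hexes t n).
Proof.
have moveE f g (X : seq (tile R)) (Y : seq (seq plane)) :
    (forall p, f (stretch p) = stretch (g p)) ->
    map (@corners R) X = map (map stretch) Y ->
    map (@corners R) (map (move_tile f) X) = map (map stretch) (map (map g) Y).
  move=> fg e; transitivity (map (map f) (map (@corners R) X)).
    by rewrite -!map_comp; apply: eq_map => T; exact: map_comp.
  rewrite e -!map_comp; apply: eq_map => c /=; rewrite -!map_comp.
  by apply: eq_map => p; exact: fg.
elim/ltn_ind: n => -[|[|n]] IH; rewrite ?A2_step.
- by rewrite -[LHS]/[:: map id (hexagon R)] map_id stretch_hexagon.
- by rewrite -[LHS]/[:: map id (hexagon R)] map_id stretch_hexagon.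
rewrite map_cat [hexes t n.+2]/= map_cat; congr (_ ++ _).
  by apply: moveE (IH n.+1 (leqnn _)); exact: stretch_f1.
by apply: moveE (IH n _); [exact: stretch_f2|].
Qed.

Lemma vertices_A2 n : vertices (A2 R n.+1) = (stretch @` patchV t n)%fset.
Proof.
apply/fsetP => z; rewrite /vertices corners_A2 in_fset /= -map_flatten.
apply/mapP/imfsetP => -[p pV ->]; exists p => //; move: pV; by rewrite !inE.
Qed.

Lemma sides_A2 n :
  flatten (map (@sides R) (A2 R n.+1)) = map (map_side stretch) (patchS t n).
Proof.
rewrite /patchS map_flatten -map_comp.
have -> : map (@sides R) (A2 R n.+1) =
    map (@polygon_sides R) (map (@corners R) (A2 R n.+1)).
  by rewrite -map_comp.
rewrite corners_A2 -map_comp; congr flatten; apply: eq_map => c /=.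
exact: polygon_sides_map.
Qed.

Lemma num_vertices_A2 n : num_vertices (A2 R n.+1) = #|` patchV t n|.
Proof.
by rewrite /num_vertices vertices_A2 card_imfset //; exact: stretch_inj.
Qed.

Lemma degree_sum_A2 n : degree_sum (A2 R n.+1) = (2 * #|` patchE t n|)%N.
Proof.
have edgesE : edges (A2 R n.+1) =
    edge_set (flatten (map (@sides R) (A2 R n.+1))) (vertices (A2 R n.+1)) by [].
rewrite /degree_sum /degree handshake.
  rewrite edgesE sides_A2 vertices_A2 card_edge_set_affine //.
    exact: stretch_affine.
  exact: stretch_inj.
move=> e; rewrite edgesE => /edge_setP[x [y [[xW yW xy _ _] ->]]].
by exists x, y.
Qed.

End Tiling.

(** * Solving the recurrences *)

Section Numbers.
Variable R : realType.
Local Notation s5 := (Num.sqrt 5 : R).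
Local Notation t := (Psi R ^+ 2).

Lemma fibSS n : fib n.+2 = (fib n.+1 + fib n)%N. Proof. by []. Qed.

(** The contribution of the seam depends only on half the generation, so the
    recurrence is solved two generations at a time. *)
Lemma num_vertices_pairs i :
  num_vertices (A2 R (i.*2 + 7)) =
    (1 + 31 * fib i.*2.+1 + 19 * fib i.*2 + fib (i + 6))%N /\
  num_vertices (A2 R (i.*2 + 8)) =
    (1 + 31 * fib i.*2.+2 + 19 * fib i.*2.+1 + 2 * fib (i + 5))%N.
Proof.
rewrite !addnS addn0 !num_vertices_A2.
have rec := card_patchV_rec (tau_gt0 R) (tau_sq R).
elim: i => [|i [IH7 IH8]].
  (* The base values 40 and 61 come from 6 and 6 by six recurrence steps. *)
  have v0 := card_patchV_hexagon (tau_gt0 R) (tau_sq R) (isT : (0 < 2)%N).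
  have v1 := card_patchV_hexagon (tau_gt0 R) (tau_sq R) (isT : (1 < 2)%N).
  have := rec 0%N; have := rec 1%N; have := rec 2%N; have := rec 3%N.
  have := rec 4%N; have := rec 5%N; rewrite double0 v0 ?v1 /=; lia.
have rec8 : (#|` patchV t i.*2.+4.+4| + 1 + fib i.+3 + fib i.+3 + fib i.+2 =
    #|` patchV t i.*2.+4.+3| + #|` patchV t i.*2.+4.+2|)%N.
  rewrite (_ : i.+3 = (i.*2.+4.+2 - 3)./2.+2)%N; last by lia.
  rewrite {2}(_ : (i.*2.+4.+2 - 3)./2 = (i.*2.+4.+2 - 4)./2)%N; last by lia.
  rewrite (_ : i.+2 = (i.*2.+4.+2 - 5)./2.+2)%N; last by lia.
  exact: rec.
have rec9 : (#|` patchV t i.*2.+4.+4.+1| + 1 + fib i.+4 + fib i.+3 + fib i.+3 =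
    #|` patchV t i.*2.+4.+4| + #|` patchV t i.*2.+4.+3|)%N.
  rewrite (_ : i.+4 = (i.*2.+4.+3 - 3)./2.+2)%N; last by lia.
  rewrite (_ : i.+3 = (i.*2.+4.+3 - 4)./2.+2)%N; last by lia.
  rewrite {2}(_ : (i.*2.+4.+3 - 4)./2 = (i.*2.+4.+3 - 5)./2)%N; last by lia.
  exact: rec.
move: rec9 rec8; rewrite doubleS addn0 in IH7 IH8 *; rewrite addn0 IH7 IH8.
rewrite !fibSS; lia.
Qed.

Lemma degree_sum_euler n :
  (degree_sum (A2 R n.+1) + 2 = 2 * num_vertices (A2 R n.+1) + 2 * fib n.+1)%N.
Proof.
rewrite num_vertices_A2 degree_sum_A2.
by have := euler (tau_gt0 R) (tau_sq R) n; lia.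
Qed.

Lemma fib_add7 m : fib (m + 7) = (13 * fib m.+1 + 8 * fib m)%N.
Proof. by rewrite !addnS addn0 !fibSS; lia. Qed.

Lemma degree_sum_pairs i :
  degree_sum (A2 R (i.*2 + 7)) =
    (88 * fib i.*2.+1 + 54 * fib i.*2 + 2 * fib (i + 6))%N /\
  degree_sum (A2 R (i.*2 + 8)) =
    (88 * fib i.*2.+2 + 54 * fib i.*2.+1 + 4 * fib (i + 5))%N.
Proof.
have [v7 v8] := num_vertices_pairs i.
have := degree_sum_euler (i.*2 + 6); have := degree_sum_euler (i.*2 + 7).
rewrite -!addnS v7 v8 fib_add7 (_ : i.*2 + 8 = i.*2.+1 + 7)%N; last by lia.
by rewrite fib_add7 !(fibSS i.*2); lia.
Qed.

Lemma sqrt5_neq0 : s5 != 0.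
Proof. by rewrite gt_eqF // sqrtr_gt0. Qed.

Lemma sqrt5_inv : s5^-1 = s5 / 5.
Proof.
apply: (mulfI sqrt5_neq0); rewrite divff ?sqrt5_neq0 // mulrA sqrt5_sq.
by rewrite divff.
Qed.

(** Both sides satisfy the Fibonacci recurrence, since (1 + sqrt 5) / 2 and
    (1 - sqrt 5) / 2 are the roots of x^2 = x + 1. *)
Lemma binet (c d : R) (a b : nat) :
  c + d = a%:R -> c * ((1 + s5) / 2) + d * ((1 - s5) / 2) = (a + b)%:R ->
  forall m, c * ((1 + s5) / 2) ^+ m + d * ((1 - s5) / 2) ^+ m =
            (a * fib m.+1 + b * fib m)%:R.
Proof.
move=> h0 h1; have ss := sqrt5_sq R.
have rec (x : R) m : x * x = x + 1 -> x ^+ m.+2 = x ^+ m.+1 + x ^+ m.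
  by move=> xx; rewrite !exprS mulrA xx mulrDl mul1r.
suff both m : c * ((1 + s5) / 2) ^+ m + d * ((1 - s5) / 2) ^+ m =
    (a * fib m.+1 + b * fib m)%:R /\
  c * ((1 + s5) / 2) ^+ m.+1 + d * ((1 - s5) / 2) ^+ m.+1 =
    (a * fib m.+2 + b * fib m.+1)%:R by move=> m; case: (both m).
elim: m => [|m [IH0 IH1]].
  by rewrite !expr0 !expr1 !mulr1 [fib 2]/= [fib 1]/= [fib 0]/= !muln1 muln0 addn0.
split=> //; rewrite !rec; [|lra|lra].
rewrite (fibSS m.+1) (fibSS m) !mulrDr addrACA IH1 IH0 -natrD; congr (_%:R).
by rewrite !(fibSS m); lia.
Qed.

Lemma binet_vertices m :
  (31 / 2 + 69 / (2 * s5)) * ((1 + s5) / 2) ^+ m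
    + (31 / 2 - 69 / (2 * s5)) * ((1 - s5) / 2) ^+ m =
  (31 * fib m.+1 + 19 * fib m)%:R.
Proof.
have ss := sqrt5_sq R.
by apply: binet; rewrite invfM sqrt5_inv; nra.
Qed.

Lemma binet_degrees m :
  (44 + 98 / s5) * ((1 + s5) / 2) ^+ m
    + (44 - 98 / s5) * ((1 - s5) / 2) ^+ m =
  (88 * fib m.+1 + 54 * fib m)%:R.
Proof.
have ss := sqrt5_sq R.
by apply: binet; rewrite sqrt5_inv; nra.
Qed.

Lemma even_index k : (7 <= k)%N -> ~~ odd k -> exists i, k = (i.*2 + 8)%N.
Proof.
move=> k7 ke; exists (k./2 - 4)%N; have := odd_double_half k.
by rewrite (negPf ke); lia.
Qed.

Lemma odd_index k : (7 <= k)%N -> odd k -> exists i, k = (i.*2 + 7)%N.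
Proof.
by move=> k7 ko; exists (k./2 - 3)%N; have := odd_double_half k; rewrite ko; lia.
Qed.

Lemma counts_even k : (7 <= k)%N -> ~~ odd k ->
  (num_vertices (A2 R k))%:R =
    1 + 1 / 2 * (fib (k %/ 2))%:R + (fib (k %/ 2 + 1))%:R
    + 2 * (fib (k %/ 2 - 1))%:R - 1 / 2 * (fib (k %/ 2 - 3))%:R
    + (31 / 2 + 69 / (2 * s5)) * ((1 + s5) / 2) ^+ (k - 7)
    + (31 / 2 - 69 / (2 * s5)) * ((1 - s5) / 2) ^+ (k - 7) :> R
  /\
  (degree_sum (A2 R k))%:R =
    (fib (k %/ 2))%:R + 2 * (fib (k %/ 2 + 1))%:R
    + 4 * (fib (k %/ 2 - 1))%:R - (fib (k %/ 2 - 3))%:R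
    + (44 + 98 / s5) * ((1 + s5) / 2) ^+ (k - 7)
    + (44 - 98 / s5) * ((1 - s5) / 2) ^+ (k - 7) :> R.
Proof.
move=> k7 ke; have [i ->] := even_index k7 ke.
have [_ ->] := num_vertices_pairs i; have [_ ->] := degree_sum_pairs i.
rewrite -![_ + _ + (_ - _) * _]addrA binet_vertices binet_degrees.
have -> : (i.*2 + 8 - 7 = i.*2.+1)%N by lia.
have -> : ((i.*2 + 8) %/ 2 = i.+4)%N by lia.
have -> : (i.+4 - 1 = i.+3)%N by lia.
have -> : (i.+4 - 3 = i.+1)%N by lia.
rewrite !addnS !addn0 !(fibSS i.+3) !(fibSS i.+2) !(fibSS i.+1).
move: (fib i.*2.+2) (fib i.*2.+1) (fib i.+2) (fib i.+1) => a b c d.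
by rewrite !(natrD, natrM); split; lra.
Qed.

Lemma counts_odd k : (7 <= k)%N -> odd k ->
  (num_vertices (A2 R k))%:R =
    1 + 2 * (fib ((k + 1) %/ 2))%:R + (fib ((k - 1) %/ 2))%:R
    + (31 / 2 + 69 / (2 * s5)) * ((1 + s5) / 2) ^+ (k - 7)
    + (31 / 2 - 69 / (2 * s5)) * ((1 - s5) / 2) ^+ (k - 7) :> R
  /\
  (degree_sum (A2 R k))%:R =
    4 * (fib ((k + 1) %/ 2))%:R + 2 * (fib ((k - 1) %/ 2))%:R
    + (44 + 98 / s5) * ((1 + s5) / 2) ^+ (k - 7)
    + (44 - 98 / s5) * ((1 - s5) / 2) ^+ (k - 7) :> R.
Proof.
move=> k7 ke; have [i ->] := odd_index k7 ke.
have [-> _] := num_vertices_pairs i; have [-> _] := degree_sum_pairs i.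
rewrite -![_ + _ + (_ - _) * _]addrA binet_vertices binet_degrees.
have -> : (i.*2 + 7 - 7 = i.*2)%N by lia.
have -> : ((i.*2 + 7 + 1) %/ 2 = i.+4)%N by lia.
have -> : ((i.*2 + 7 - 1) %/ 2 = i.+3)%N by lia.
rewrite !addnS !addn0 !(fibSS i.+4) !(fibSS i.+3) !(fibSS i.+2) !(fibSS i.+1).
move: (fib i.*2.+1) (fib i.*2) (fib i.+2) (fib i.+1) => a b c d.
by rewrite !(natrD, natrM); split; lra.
Qed.

(** * The average degree in the limit *)

(** What remains of the numbers of vertices when the terms of order phi^m are
    taken away; it comes from the boundary and the seams. *)
Definition boundary_term m : nat :=
  if odd m then (2 * fib (m./2 + 5))%N else fib (m./2 + 6).

Lemma counts_add7 m :
  num_vertices (A2 R (m + 7)) =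
    (1 + 31 * fib m.+1 + 19 * fib m + boundary_term m)%N /\
  degree_sum (A2 R (m + 7)) =
    (88 * fib m.+1 + 54 * fib m + 2 * boundary_term m)%N.
Proof.
rewrite /boundary_term; have := odd_double_half m; set i := m./2.
have [v7 v8] := num_vertices_pairs i; have [d7 d8] := degree_sum_pairs i.
case: (odd m) => <-.
  rewrite (_ : true + i.*2 + 7 = i.*2 + 8)%N; last by lia.
  by rewrite v8 d8 add1n mulnA.
by rewrite v7 d7 add0n.
Qed.

Lemma fib_le_phi n : (fib n)%:R <= phi R ^+ n.
Proof.
have p1 := phi_gt1 R; have pp := phi_sq R; have p0 := phi_gt0 R.
suff [] : (fib n)%:R <= phi R ^+ n /\ (fib n.+1)%:R <= phi R ^+ n.+1 by [].
elim: n => [|n [IH0 IH1]]; first by rewrite expr0 expr1 /= ler01 ltW.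
split=> //; rewrite !exprS mulrA pp mulrDl mul1r -exprS fibSS natrD.
exact: lerD.
Qed.

Lemma phi_tau m : phi R ^+ m * t ^+ m = 1.
Proof. by rewrite -exprMn Psi_sq divff ?expr1n // gt_eqF ?phi_gt0. Qed.

(** The two roots of x^2 = x + 1 have product -1. *)
Lemma phi_conj : (1 - s5) / 2 = - t.
Proof.
have p0 : phi R != 0 by rewrite gt_eqF ?phi_gt0.
apply: (mulfI p0); rewrite mulrN Psi_sq divff // /phi.
by have := sqrt5_sq R; lra.
Qed.

(** The half index in [boundary_term] gives phi^(m/2), and t^m phi^(m/2) is about
    Psi^m because phi = Psi^-2. *)
Lemma boundary_term_bound m :
  0 <= (boundary_term m)%:R * t ^+ m <= 2 * phi R ^+ 6 * Psi R ^+ m.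
Proof.
have p0 := phi_gt0 R; have P0 := Psi_gt0 R; have p1 := phi_gt1 R.
have P1 : Psi R <= 1.
  by rewrite invf_le1 ?sqrtr_gt0 // -[leLHS]sqrtr1 ler_sqrt ltW // ltW.
rewrite mulr_ge0 ?exprn_ge0 ?ler0n //=; last by rewrite ltW.
have r_le : (boundary_term m)%:R <= 2 * phi R ^+ 6 * phi R ^+ m./2.
  rewrite -mulrA -exprD addnC /boundary_term; case: (odd m).
    rewrite natrM ler_pM2l // (le_trans (fib_le_phi _)) //.
    by rewrite ler_weXn2l ?leq_add2l // ltW.
  rewrite (le_trans (fib_le_phi _)) // ler_peMl ?exprn_ge0 ?ltW //.
  by rewrite ltr1n.
have half : phi R ^+ m./2 * Psi R ^+ m <= 1.
  rewrite -{2}(odd_double_half m) exprD mulrCA -mul2n exprM phi_tau mulr1.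
  by rewrite exprn_ile1 // ltW.
rewrite -exprM mul2n -addnn exprD mulrA ler_pM2r ?exprn_gt0 //.
apply: (@le_trans _ _ (2 * phi R ^+ 6 * phi R ^+ m./2 * Psi R ^+ m)).
  by rewrite ler_pM2r ?exprn_gt0.
by rewrite -mulrA ler_piMr // mulr_ge0 ?exprn_ge0 ?ltW.
Qed.

Lemma cvg_boundary_term : (boundary_term m)%:R * t ^+ m @[m --> \oo] --> (0 : R).
Proof.
have P0 := Psi_gt0 R.
have P1 : `|Psi R| < 1.
  rewrite gtr0_norm // invf_lt1 ?sqrtr_gt0 ?phi_gt0 // -[ltLHS]sqrtr1.
  by rewrite ltr_sqrt ?phi_gt1 ?phi_gt0.
apply: (@squeeze_cvgr _ _ _ _ (fun=> 0) (fun m => 2 * phi R ^+ 6 * Psi R ^+ m)).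
- by near=> m; exact: boundary_term_bound.
- exact: cvg_cst.
- rewrite -[X in _ --> X](mulr0 (2 * phi R ^+ 6)).
  by apply: cvgMl_tmp; exact: cvg_expr.
Unshelve. all: by end_near. Qed.

Lemma cvg_conj_power c : c * (- t * t) ^+ m @[m --> \oo] --> (0 : R).
Proof.
rewrite -[X in _ --> X](mulr0 c); apply: cvgMl_tmp; apply: cvg_expr.
have t0 := tau_gt0 R; have tt := tau_sq R.
by rewrite mulNr normrN tt ger0_norm; nra.
Qed.

(** Multiplication by t^m = phi^-m leaves c, since the conjugate root has absolute
    value t < 1 and the remaining term is negligible. *)
Lemma cvg_counts (c d : R) (a r : nat -> nat) :
  (forall m, c * ((1 + s5) / 2) ^+ m + d * ((1 - s5) / 2) ^+ m = (a m)%:R) ->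
  (forall m, (r m <= 2 * boundary_term m + 1)%N) ->
  (a m + r m)%:R * t ^+ m @[m --> \oo] --> c.
Proof.
move=> ae rb; have P0 := Psi_gt0 R; have t0 := tau_gt0 R.
have t1 : `|t| < 1 by rewrite gtr0_norm //; have := tau_sq R; nra.
have split_count m : (a m + r m)%:R * t ^+ m =
    c + d * (- t * t) ^+ m + (r m)%:R * t ^+ m.
  have := phi_tau m; have := ae m; rewrite phi_conj -/(phi R) natrD => <-.
  rewrite (exprMn m (- t) t); move: (phi R ^+ m) (t ^+ m) ((- t) ^+ m) => X Y Z XY.
  by ring: XY.
rewrite (funext split_count) -[X in _ --> X](_ : c + 0 + 0 = c); last first.
  by rewrite !addr0.
apply: cvgD; first by apply: cvgD; [exact: cvg_cst | exact: cvg_conj_power].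
apply: (@squeeze_cvgr _ _ _ _ (fun=> 0)
  (fun m => 2 * ((boundary_term m)%:R * t ^+ m) + t ^+ m)).
- near=> m; apply/andP; split.
    by apply: mulr_ge0; [exact: ler0n | apply: exprn_ge0; exact: ltW].
  rewrite mulrA -[X in _ <= _ + X]mul1r -mulrDl.
  rewrite ler_pM2r ?exprn_gt0 // (le_trans (_ : _ <= (2 * boundary_term m + 1)%:R)) //.
    by rewrite ler_nat.
  by rewrite natrD natrM.
- exact: cvg_cst.
- rewrite -[X in _ --> X](_ : 2 * 0 + 0 = 0); last by rewrite mulr0 addr0.
  by apply: cvgD; [apply: cvgMl_tmp; exact: cvg_boundary_term | exact: cvg_expr].
Unshelve. all: by end_near. Qed.

Lemma limit_denominator_gt0 : 0 < 31 / 2 + 69 / (2 * s5).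
Proof.
by apply: addr_gt0; apply: divr_gt0 => //; apply: mulr_gt0; rewrite // sqrtr_gt0.
Qed.

Lemma cvg_avg_degree :
  avg_degree (A2 R k) @[k --> \oo] -->
    ((44 + 98 / s5) / (31 / 2 + 69 / (2 * s5)) : R).
Proof.
have t0 := tau_gt0 R.
rewrite -(cvg_shiftn 7).
have -> : [sequence avg_degree (A2 R (m + 7))]_m = (fun m =>
    ((88 * fib m.+1 + 54 * fib m) + 2 * boundary_term m)%:R * t ^+ m *
    (((31 * fib m.+1 + 19 * fib m) + (1 + boundary_term m))%:R * t ^+ m)^-1).
  apply/funext => m; rewrite /avg_degree /=; have [-> ->] := counts_add7 m.
  have -> : (1 + 31 * fib m.+1 + 19 * fib m + boundary_term m =
    31 * fib m.+1 + 19 * fib m + (1 + boundary_term m))%N by lia.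
  have T0 : t ^+ m != 0 by rewrite expf_neq0 // gt_eqF.
  by rewrite -mulf_div (divff T0) mulr1.
apply: cvgM; first by apply: cvg_counts binet_degrees _ => m; lia.
apply: cvgV; first exact: lt0r_neq0 limit_denominator_gt0.
by apply: cvg_counts binet_vertices _ => m; lia.
Qed.

Lemma limit_value :
  (44 + 98 / s5) / (31 / 2 + 69 / (2 * s5)) = 2 / 11 * (14 + phi R).
Proof.
have d0 := lt0r_neq0 limit_denominator_gt0.
apply: (mulIf d0); rewrite divfK // invfM sqrt5_inv /phi.
by have := sqrt5_sq R; nra.
Qed.

End Numbers.

Theorem theorem3p1 (R : realType) :
  [/\
    forall k : nat, (7 <= k)%N -> ~~ odd k ->
      (num_vertices (A2 R k))%:R =
        1 + 1 / 2 * (fib (k %/ 2))%:R + (fib (k %/ 2 + 1))%:R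
        + 2 * (fib (k %/ 2 - 1))%:R - 1 / 2 * (fib (k %/ 2 - 3))%:R
        + (31 / 2 + 69 / (2 * Num.sqrt 5)) * ((1 + Num.sqrt 5) / 2) ^+ (k - 7)
        + (31 / 2 - 69 / (2 * Num.sqrt 5)) * ((1 - Num.sqrt 5) / 2) ^+ (k - 7)
        :> R
      /\
      (degree_sum (A2 R k))%:R =
        (fib (k %/ 2))%:R + 2 * (fib (k %/ 2 + 1))%:R
        + 4 * (fib (k %/ 2 - 1))%:R - (fib (k %/ 2 - 3))%:R
        + (44 + 98 / Num.sqrt 5) * ((1 + Num.sqrt 5) / 2) ^+ (k - 7)
        + (44 - 98 / Num.sqrt 5) * ((1 - Num.sqrt 5) / 2) ^+ (k - 7)
        :> R,
    forall k : nat, (7 <= k)%N -> odd k ->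
      (num_vertices (A2 R k))%:R =
        1 + 2 * (fib ((k + 1) %/ 2))%:R + (fib ((k - 1) %/ 2))%:R
        + (31 / 2 + 69 / (2 * Num.sqrt 5)) * ((1 + Num.sqrt 5) / 2) ^+ (k - 7)
        + (31 / 2 - 69 / (2 * Num.sqrt 5)) * ((1 - Num.sqrt 5) / 2) ^+ (k - 7)
        :> R
      /\
      (degree_sum (A2 R k))%:R =
        4 * (fib ((k + 1) %/ 2))%:R + 2 * (fib ((k - 1) %/ 2))%:R
        + (44 + 98 / Num.sqrt 5) * ((1 + Num.sqrt 5) / 2) ^+ (k - 7)
        + (44 - 98 / Num.sqrt 5) * ((1 - Num.sqrt 5) / 2) ^+ (k - 7)
        :> R,
    forall k : nat, (1 <= k)%N ->
      avg_degree (A2 R k) =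
        (degree_sum (A2 R k))%:R / (num_vertices (A2 R k))%:R,
    avg_degree (A2 R k) @[k --> \oo] -->
      ((44 + 98 / Num.sqrt 5) / (31 / 2 + 69 / (2 * Num.sqrt 5)) : R)
  & (44 + 98 / Num.sqrt 5) / (31 / 2 + 69 / (2 * Num.sqrt 5)) =
      2 / 11 * (14 + phi R) :> R ].
Proof.
split=> [k|k|//||].
- exact: counts_even.
- exact: counts_odd.
- exact: cvg_avg_degree.
- exact: limit_value.
Qed.
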